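(* Let $S_1\neq S_2$ be two circles in $\mathbb{R}^2$ and let $U\subset\mathbb{R}^2$ be a simply-connected region nicely arranged with respect to $S_1$ and $S_2$. Let $F$ be a function biharmonic in $U$. Suppose that for each $t=1,2$ the restriction $F|_{S_t\cap U}$ is a restriction of a linear function. Then $F$ extends to a function biharmonic in the open set $r_1(U)\cap r_2(U)-\Sigma_{12}$.
   Context: Biharmonic means $\Delta(\Delta F)=0$; a linear function is one of the form $\alpha x+\beta y+\gamma$. For a circle $S_t$ with center $O_t$, $r_t:\mathbb{R}^2-\{O_t\}\to\mathbb{R}^2-\{O_t\}$ is the reflection (inversion) with respect to $S_t$, and $r_t(U)$ is shorthand for $r_t(U-\{O_t\})$. The limit set is $\Sigma_{12}=\{x\in\mathbb{R}^2: r_1(x)=r_2(x)\}$ (at most two points for $S_1\ne S_2$). A region $U$ is nicely arranged with respect to $S_1$ and $S_2$ if the set $U\cap r_1(U)\cap r_2(U)-\Sigma_{12}$ has a connected component $D$ such that $S_1\cap D\neq\emptyset$ and $S_2\cap D\neq\emptyset$. A function $F$ biharmonic in $U$ extends to a function $G$ biharmonic in an open set $V$ if there is a nonempty open set $D\subset U\cap V$ such that $F=G$ in $D$ ($F$ may differ from $G$ elsewhere in $U\cap V$ if that set is disconnected). *)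

(* Defs.v *)
(* Library: MathComp-Analysis; the plane is [R * R] with [R : realType]. *)
From HB Require Import structures.
From mathcomp Require Import all_boot all_order all_algebra.
From mathcomp Require Import all_classical all_reals all_analysis.

Set Implicit Arguments.
Unset Strict Implicit.
Unset Printing Implicit Defensive.

Import Order.TTheory GRing.Theory Num.Theory.
Import numFieldNormedType.Exports.

Local Open Scope classical_set_scope.
Local Open Scope ring_scope.

Section Topology.
Context {R : realType}.

Definition region (U : set (R * R)) : Prop :=
  [/\ open U, connected U & U !=set0].

Definition curve_in (U : set (R * R)) (g : R -> R * R) : Prop :=
  {within `[0, 1]%classic, continuous g} /\
  (forall t : R, `[0, 1]%classic t -> U (g t)).

Definition path_connected (U : set (R * R)) : Prop :=
  forall p q, U p -> U q ->
  exists g, [/\ curve_in U g, g 0 = p & g 1 = q].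

(* [H (s, t)] is at stage s of the deformation, which fixes the base point. *)
Definition null_homotopic (U : set (R * R)) (g : R -> R * R) : Prop :=
  exists H : R * R -> R * R,
  [/\ {within `[0, 1]%classic `*` `[0, 1]%classic, continuous H},
      forall z : R * R, (`[0, 1]%classic `*` `[0, 1]%classic) z -> U (H z),
      forall t : R, `[0, 1]%classic t -> H (0, t) = g t,
      forall t : R, `[0, 1]%classic t -> H (1, t) = g 0 &
      forall s : R, `[0, 1]%classic s -> H (s, 0) = g 0 /\ H (s, 1) = g 0].

Definition simply_connected (U : set (R * R)) : Prop :=
  path_connected U /\
  forall g, curve_in U g -> g 0 = g 1 -> null_homotopic U g.

Definition is_component (A D : set (R * R)) : Prop :=
  exists2 p, A p & D = connected_component A p.

End Topology.

Section Biharmonic.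
Context {R : realType}.

Definition ex : R * R := (1, 0).
Definition ey : R * R := (0, 1).

(* Class C^k on U; meaningful for open U, where the values of the total
   function outside U are irrelevant. *)
Fixpoint class_C (k : nat) (U : set (R * R)) (F : R * R -> R) : Prop :=
  (forall p, U p -> {for p, continuous F}) /\
  if k is k'.+1 then
    [/\ forall p, U p -> derivable F p ex /\ derivable F p ey,
        class_C k' U ('D_ex F) & class_C k' U ('D_ey F)]
  else True.

Definition laplacian (F : R * R -> R) (p : R * R) : R :=
  'D_ex ('D_ex F) p + 'D_ey ('D_ey F) p.

Definition biharmonic (U : set (R * R)) (F : R * R -> R) : Prop :=
  class_C 4 U F /\ forall p, U p -> laplacian (laplacian F) p = 0.

Definition extends_biharmonically (U : set (R * R)) (F : R * R -> R)
    (V : set (R * R)) : Prop :=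
  open V /\
  exists2 G : R * R -> R, biharmonic V G &
  exists D : set (R * R),
    [/\ open D, D !=set0, D `<=` U `&` V & forall p, D p -> F p = G p].

Definition linear_on (A : set (R * R)) (F : R * R -> R) : Prop :=
  exists alpha beta gamma : R,
  forall p, A p -> F p = alpha * p.1 + beta * p.2 + gamma.

End Biharmonic.

Section Circles.
Context {R : realType}.

(* The library norm on [R * R] is the sup norm. *)
Definition enorm (p : R * R) : R := Num.sqrt (p.1 ^+ 2 + p.2 ^+ 2).

Definition circle (O : R * R) (a : R) : set (R * R) :=
  [set p | enorm (p - O) = a].

(* Relevant only for p <> O; the value at O is junk. *)
Definition inversion (O : R * R) (a : R) (p : R * R) : R * R :=
  O + (a ^+ 2 / enorm (p - O) ^+ 2) *: (p - O).

Definition inversion_image (O : R * R) (a : R) (U : set (R * R))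
    : set (R * R) :=
  inversion O a @` (U `\ O).

Definition limit_set (O1 : R * R) (a1 : R) (O2 : R * R) (a2 : R)
    : set (R * R) :=
  [set p | [/\ p <> O1, p <> O2 & inversion O1 a1 p = inversion O2 a2 p]].

Definition nicely_arranged (O1 : R * R) (a1 : R) (O2 : R * R) (a2 : R)
    (U : set (R * R)) : Prop :=
  exists D : set (R * R),
  [/\ is_component
        ((U `&` inversion_image O1 a1 U `&` inversion_image O2 a2 U)
           `\` limit_set O1 a1 O2 a2) D,
      circle O1 a1 `&` D !=set0 & circle O2 a2 `&` D !=set0].

End Circles.

(* Main.v *)
Require Import Defs.
From HB Require Import structures.
From mathcomp Require Import all_boot all_order all_algebra.
From mathcomp Require Import all_classical all_reals all_analysis.
From mathcomp Require Import complex ring lra.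
Import Order.TTheory GRing.Theory Num.Theory.
Import numFieldNormedType.Exports.
Local Open Scope classical_set_scope.
Local Open Scope ring_scope.

(** The plane is identified with the complex numbers.  On a simply connected region
    a biharmonic function has Goursat's form [F = Re (conj z * f + g)] with [f] and
    [g] holomorphic ([goursat_representation]).  On the circle with centre [O] and
    radius [a] the function [conj z] agrees with the Schwarz function
    [s z = conj O + a ^ 2 / (z - O)], which is holomorphic off [O] and whose
    conjugate is the inversion.  If [F] coincides there with the real part of an
    affine function [l], then [s f + g - l] is holomorphic with vanishing real part
    on the circle, and [z |-> - conj ((s f + g - l) (r z))], where [r] is the
    inversion, continues it to [r U] ([schwarz_reflection]).

    With two circles this yields holomorphic continuations [K1] and [K2] of
    [s1 f + g] and [s2 f + g] to the two inverted regions.  On the intersection of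
    these regions, the linear system in [f] and [g] can be solved wherever
    [s1 <> s2], that is off the limit set: [f = (K1 - K2) / (s1 - s2)] and
    [g = K1 - s1 f].  The resulting pair defines the extension.  It agrees with [F]
    near the component given by the nice arrangement: that component meets both
    circles, so the identity theorem propagates both equations
    [Kt = st f + g] over the whole of it.

    The function theory needed for this is developed here from complex
    differentiability.  A function is called holomorphic if it is twice complex
    differentiable; its second-order expansion then shows that its mean over four
    points [z + i^j h] is its value at [z] up to [o(h^2)], and this gives the maximum
    principle ([max_modulus]) without integration.  Cauchy's estimates follow by
    applying the maximum principle to powers of difference quotients; they bound
    the difference quotients of the second derivative well enough to make them
    converge ([third_derivative]), so derivatives of holomorphic functions are
    holomorphic and Goursat forms are smooth.  The identity theorem comes from
    dividing by the zeros ([many_zeros_small]).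

    Goursat's form itself requires harmonic conjugates and primitives, that is,
    potentials of closed forms.  On squares these are integrals
    ([local_potential]); on a simply connected region the increments of the local
    potentials are summed along fine subdivisions of paths, and a homotopy shows
    that the sums do not depend on the path ([global_potential]). *)

Set Implicit Arguments.
Unset Strict Implicit.
Unset Printing Implicit Defensive.

(** * Complex numbers as points of the plane *)

(** The modulus, retyped with values in [R] itself and protected from
    simplification, so that linear arithmetic treats it as an atom. *)
Definition normc {R : realType} (z : R[i]) : R := Normc.normc z.
Arguments normc : simpl never.

Section ComplexPlane.
Context {R : realType}.
Local Notation P := (R * R)%type.
Local Notation C := R[i].
Local Notation re := (@complex.Re R).
Local Notation im := (@complex.Im R).
Implicit Types (p w : P) (z a b : C).

Definition cx p : C := (p.1 +i* p.2)%C.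
Definition pt z : P := (re z, im z).

Lemma cxK p : pt (cx p) = p. Proof. by case: p. Qed.
Lemma ptK z : cx (pt z) = z. Proof. by case: z. Qed.
Lemma cx_inj p w : cx p = cx w -> p = w.
Proof. by move=> h; rewrite -(cxK p) h cxK. Qed.

Lemma reD a b : re (a + b) = re a + re b. Proof. by case: a; case: b. Qed.
Lemma imD a b : im (a + b) = im a + im b. Proof. by case: a; case: b. Qed.
Lemma reN a : re (- a) = - re a. Proof. by case: a. Qed.
Lemma imN a : im (- a) = - im a. Proof. by case: a. Qed.
Lemma reM a b : re (a * b) = re a * re b - im a * im b.
Proof. by case: a; case: b. Qed.
Lemma imM a b : im (a * b) = re a * im b + im a * re b.
Proof. by case: a; case: b. Qed.
Lemma re0 : re 0 = 0. Proof. by []. Qed.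
Lemma im0 : im 0 = 0. Proof. by []. Qed.
Lemma re1 : re 1 = 1. Proof. by []. Qed.
Lemma im1 : im 1 = 0. Proof. by []. Qed.
Lemma reJ a : re (conjc a) = re a. Proof. by case: a. Qed.
Lemma imJ a : im (conjc a) = - im a. Proof. by case: a. Qed.
Lemma reR (x : R) : re (x%:C)%C = x. Proof. by []. Qed.
Lemma imR (x : R) : im (x%:C)%C = 0. Proof. by []. Qed.
Definition riE := (reD, imD, reN, imN, reM, imM, reJ, imJ, reR, imR, re0, im0, re1, im1).

Lemma complex_eq a b : re a = re b -> im a = im b -> a = b.
Proof. by case: a; case: b => ? ? ? ? /= -> ->. Qed.

Lemma normcE a : normc a = Num.sqrt (re a ^+ 2 + im a ^+ 2).
Proof. by case: a. Qed.
Lemma normc_ge0 a : 0 <= normc a. Proof. by rewrite normcE sqrtr_ge0. Qed.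
Lemma sqr_normc a : normc a ^+ 2 = re a ^+ 2 + im a ^+ 2.
Proof. by rewrite normcE sqr_sqrtr // addr_ge0 ?sqr_ge0. Qed.
Lemma normc_eq0 a : (normc a == 0) = (a == 0).
Proof.
rewrite /normc.
by apply/eqP/eqP => [/Normc.eq0_normc //|->]; rewrite Normc.normc0.
Qed.
Lemma normc_gt0 a : (0 < normc a) = (a != 0).
Proof. by rewrite lt0r normc_eq0 normc_ge0 andbT. Qed.
Lemma normcr0 : normc (0 : C) = 0. Proof. by apply/eqP; rewrite normc_eq0. Qed.
Lemma normcr1 : normc (1 : C) = 1.
Proof. by rewrite normcE /= expr0n addr0 expr1n sqrtr1. Qed.
Lemma normcrM a b : normc (a * b) = normc a * normc b.
Proof. exact: Normc.normcM. Qed.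
Lemma normcrV a : normc a^-1 = (normc a)^-1.
Proof. exact: Normc.normcV. Qed.
Lemma normc_conj a : normc (conjc a) = normc a.
Proof. by rewrite !normcE !riE sqrrN. Qed.
Lemma normc_real (x : R) : normc (x%:C)%C = `|x|.
Proof. by rewrite normcE !riE expr0n addr0 sqrtr_sqr. Qed.
Lemma le_normc_add a b : normc (a + b) <= normc a + normc b.
Proof. exact: le_normcD. Qed.
Lemma normc_opp a : normc (- a) = normc a. Proof. exact: normcN. Qed.
Lemma le_normc_sub a b : normc (a - b) <= normc a + normc b.
Proof. by rewrite -(normc_opp b) le_normc_add. Qed.
Lemma normc_exp a n : normc (a ^+ n) = normc a ^+ n.
Proof.
by elim: n => [|n IH]; rewrite ?expr0 ?normcr1 // !exprS normcrM IH.
Qed.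
Lemma normc_div a b : normc (a / b) = normc a / normc b.
Proof. by rewrite normcrM normcrV. Qed.
Lemma re_le_normc a : `|re a| <= normc a.
Proof.
rewrite normcE -sqrtr_sqr ler_sqrt ?addr_ge0 ?sqr_ge0 //.
by rewrite lerDl sqr_ge0.
Qed.
Lemma im_le_normc a : `|im a| <= normc a.
Proof.
rewrite normcE -sqrtr_sqr ler_sqrt ?addr_ge0 ?sqr_ge0 //.
by rewrite lerDr sqr_ge0.
Qed.
Lemma normc_le_add a : normc a <= `|re a| + `|im a|.
Proof.
have -> : a = (re a)%:C%C + 'i%C * (im a)%:C%C by rewrite -complexE.
apply: (le_trans (le_normc_add _ _)).
have ni : normc ('i%C : C) = 1 by rewrite normcE /= expr0n add0r expr1n sqrtr1.
by rewrite normcrM !normc_real ni mul1r -complexE.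
Qed.

(** Pairing with every unit direction detects the modulus, which reduces
    estimates of complex quantities to estimates of real parts. *)
Lemma normc_le_re a (d : R) : 0 <= d ->
  (forall c : C, re (c * a) <= normc c * d) -> normc a <= d.
Proof.
move=> d0 H; have [a0|a0] := eqVneq (normc a) 0; first by rewrite a0.
have := H (conjc a); rewrite normc_conj !riE.
have -> : re a * re a - - im a * im a = normc a * normc a.
  by rewrite -[RHS]expr2 sqr_normc; ring.
by rewrite ler_pM2l // lt0r a0 normc_ge0.
Qed.

Lemma cxB_re p w : re (cx w - cx p) = w.1 - p.1. Proof. by []. Qed.
Lemma cxB_im p w : im (cx w - cx p) = w.2 - p.2. Proof. by []. Qed.

Lemma ball_planeP p (e : R) w :
  ball p e w <-> `|p.1 - w.1| < e /\ `|p.2 - w.2| < e.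
Proof. by split => [[]|[]]. Qed.

(** The product topology of the plane is the one given by Euclidean discs. *)
Lemma near_discP p (A : P -> Prop) :
  (\forall w \near p, A w) <->
  exists2 r : R, 0 < r & forall w, normc (cx w - cx p) < r -> A w.
Proof.
split=> [/nbhs_ballP[e /= e0 eA]|[r r0 rA]].
  exists e => // w wp; apply: eA; apply/ball_planeP.
  rewrite !(distrC (p.1)) !(distrC (p.2)) -cxB_re -cxB_im.
  by split; apply: le_lt_trans wp; rewrite ?re_le_normc ?im_le_normc.
apply/nbhs_ballP; exists (r / 2) => /=; first by rewrite divr_gt0.
move=> w /ball_planeP[h1 h2]; apply: rA.
apply: (le_lt_trans (normc_le_add _)).
rewrite cxB_re cxB_im !(distrC (w.1)) !(distrC (w.2)).
by rewrite (splitr r) ltrD.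
Qed.

(** Continuity of a complex-valued function of the plane, expressed through real
    functions so that the complex numbers need no topology of their own. *)
Definition ccont (f : P -> C) p :=
  (re (f w) @[w --> p] --> re (f p)) /\ (im (f w) @[w --> p] --> im (f p)).

Lemma ccontP f p : ccont f p <->
  forall e : R, 0 < e -> \forall w \near p, normc (f w - f p) < e.
Proof.
split=> [[/cvgrPdist_lt h1 /cvgrPdist_lt h2] e e0|h].
  have e2 : 0 < e / 2 by rewrite divr_gt0.
  near=> w; apply: (le_lt_trans (normc_le_add _)).
  rewrite !riE (splitr e) ltrD // distrC; near: w.
    exact: h1.
  exact: h2.
split; apply/cvgrPdist_lt => e e0; near=> w.
  rewrite distrC -reN -reD; apply: le_lt_trans (re_le_normc _) _.
  by near: w; exact: h.
rewrite distrC -imN -imD; apply: le_lt_trans (im_le_normc _) _.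
by near: w; exact: h.
Unshelve. all: by end_near. Qed.

Lemma ccont_cst a p : ccont (fun=> a) p.
Proof. by split; apply: cvg_cst. Qed.
Lemma ccontD f g p : ccont f p -> ccont g p -> ccont (fun w => f w + g w) p.
Proof.
move=> [f1 f2] [g1 g2]; split; rewrite /=.
  under eq_fun do rewrite reD; rewrite reD; exact: cvgD.
under eq_fun do rewrite imD; rewrite imD; exact: cvgD.
Qed.
Lemma ccontN f p : ccont f p -> ccont (fun w => - f w) p.
Proof.
move=> [f1 f2]; split; rewrite /=.
  under eq_fun do rewrite reN; rewrite reN; exact: cvgN.
under eq_fun do rewrite imN; rewrite imN; exact: cvgN.
Qed.
Lemma ccontB f g p : ccont f p -> ccont g p -> ccont (fun w => f w - g w) p.
Proof. by move=> ? ?; apply: ccontD => //; exact: ccontN. Qed.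
Lemma ccontM f g p : ccont f p -> ccont g p -> ccont (fun w => f w * g w) p.
Proof.
move=> [f1 f2] [g1 g2]; split; rewrite /=.
  under eq_fun do rewrite reM; rewrite reM.
  by apply: cvgB; apply: cvgM.
under eq_fun do rewrite imM; rewrite imM.
by apply: cvgD; apply: cvgM.
Qed.
Lemma ccontJ f p : ccont f p -> ccont (fun w => conjc (f w)) p.
Proof.
move=> [f1 f2]; split; rewrite /=.
  by under eq_fun do rewrite reJ; rewrite reJ.
under eq_fun do rewrite imJ; rewrite imJ; exact: cvgN.
Qed.
Lemma ccont_cx p : ccont cx p.
Proof. by split; [exact: cvg_fst|exact: cvg_snd]. Qed.
Lemma ccont_real (u : P -> R) p :
  u w @[w --> p] --> u p -> ccont (fun w => ((u w)%:C)%C) p.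
Proof. by move=> cu; split => //=; apply: cvg_cst. Qed.
Lemma ccont_normc f p : ccont f p ->
  normc (f w) @[w --> p] --> normc (f p).
Proof.
move=> [f1 f2].
under eq_fun do rewrite normcE; rewrite normcE.
apply: (@cvg_comp _ _ _ _ Num.sqrt); last exact: sqrt_continuous.
by apply: cvgD; under eq_fun do rewrite expr2; rewrite expr2; apply: cvgM.
Qed.
(** Reduces the continuity of inverses to that of real inverses. *)
Lemma invcE a : a^-1 = ((normc a ^+ 2)^-1)%:C%C * conjc a.
Proof.
rewrite sqr_normc; case: a => x y.
have -> : (x +i* y)%C^-1 =
    ((x / (x ^+ 2 + y ^+ 2)) -i* (y / (x ^+ 2 + y ^+ 2)))%C by [].
apply: complex_eq; rewrite !riE /= mul0r.
  by rewrite subr0; exact: mulrC.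
by rewrite addr0 mulrN mulrC.
Qed.
Lemma ccontV f p : f p != 0 -> ccont f p -> ccont (fun w => (f w)^-1) p.
Proof.
move=> fp0 cf; under eq_fun do rewrite invcE.
apply: ccontM; last exact: ccontJ.
apply: ccont_real; apply: cvgV.
  by rewrite expf_eq0 /= normc_eq0.
by under eq_fun do rewrite expr2; rewrite expr2; apply: cvgM; exact: ccont_normc.
Qed.
Lemma ccontX f p n : ccont f p -> ccont (fun w => f w ^+ n) p.
Proof.
move=> cf; elim: n => [|n IH].
  by under eq_fun do rewrite expr0; exact: ccont_cst.
by under eq_fun do rewrite exprS; apply: ccontM.
Qed.
Lemma ccont_comp f (r : P -> P) p :
  ccont f (r p) -> r w @[w --> p] --> r p -> ccont (fun w => f (r w)) p.
Proof.
move=> [f1 f2] cr; split.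
  exact: (cvg_comp _ (fun q => re (f q)) cr f1).
exact: (cvg_comp _ (fun q => im (f q)) cr f2).
Qed.
Lemma continuous_pt f p : ccont f p -> pt (f w) @[w --> p] --> pt (f p).
Proof. by move=> [f1 f2]; exact: (cvg_pair f1 f2). Qed.
End ComplexPlane.

(** * Complex derivatives *)

Section ComplexDerivative.
Context {R : realType}.
Local Notation P := (R * R)%type.
Local Notation C := R[i].
Local Notation re := (@complex.Re R).
Local Notation im := (@complex.Im R).
Implicit Types (p w : P) (z a b l k A B : C) (f g : P -> C).

(** Complex differentiability in Caratheodory's form: the difference quotient
    extends continuously to [p] with value [l].  The rules of calculus become
    algebraic identities between the quotients [q]. *)
Definition cderiv f p l := exists q : P -> C,
  [/\ ccont q p, q p = l & forall w, f w = f p + q w * (cx w - cx p)].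

Lemma cxB_eq0 p w : (cx w - cx p == 0) = (w == p).
Proof.
by rewrite subr_eq0; apply/eqP/eqP => [/cx_inj //|->].
Qed.

Lemma cderivP f p l : cderiv f p l <-> forall e : R, 0 < e ->
  \forall w \near p, normc (f w - f p - l * (cx w - cx p)) <=
                     e * normc (cx w - cx p).
Proof.
split=> [[q [/ccontP cq qp fE]] e e0|H].
  have := cq _ e0; apply: filterS => w /ltW qw.
  rewrite [in f w - _]fE.
  have -> : f p + q w * (cx w - cx p) - f p - l * (cx w - cx p) =
    (q w - q p) * (cx w - cx p) by rewrite qp; ring.
  by rewrite normcrM ler_wpM2r // normc_ge0.
exists (fun w => if w == p then l else (f w - f p) / (cx w - cx p)).
split; last 2 first.
- by rewrite eqxx.
- move=> w; have [->|wp] := eqVneq w p; first by rewrite subrr mulr0 addr0.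
  by rewrite divfK ?cxB_eq0 // addrC subrK.
apply/ccontP => e e0; have e2 : 0 < e / 2 by rewrite divr_gt0.
have := H _ e2; apply: filterS => w; rewrite eqxx.
have [->|wp hw] := eqVneq w p; first by rewrite !subrr normcr0.
have wp0 : cx w - cx p != 0 by rewrite cxB_eq0.
apply: (@le_lt_trans _ _ (e / 2)); last by rewrite ltr_pdivrMr // ltr_pMr // ltr1n.
have -> : (f w - f p) / (cx w - cx p) - l =
  (f w - f p - l * (cx w - cx p)) / (cx w - cx p) by field.
by rewrite normc_div ler_pdivrMr // normc_gt0.
Qed.

Lemma cderiv_ccont f p l : cderiv f p l -> ccont f p.
Proof.
move=> [q [cq _ fE]]; rewrite (_ : f = fun w => f p + q w * (cx w - cx p)).
  apply: ccontD; first exact: ccont_cst.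
  by apply: ccontM => //; apply: ccontB; [exact: ccont_cx|exact: ccont_cst].
by apply/funext => w; rewrite {1}fE.
Qed.

Lemma near_eq_cderiv f g p l :
  (\forall w \near p, f w = g w) -> cderiv f p l -> cderiv g p l.
Proof.
move=> fg /cderivP df; apply/cderivP => e e0.
have fgp : f p = g p := nbhs_singleton fg.
have := df _ e0; rewrite fgp; move: fg.
by apply: filterS2 => w <-.
Qed.

Lemma cderiv_cst a p : cderiv (fun=> a) p 0.
Proof.
exists (fun=> 0); split => //; first exact: ccont_cst.
by move=> w; rewrite mul0r addr0.
Qed.

Lemma cderiv_cx p : cderiv cx p 1.
Proof.
exists (fun=> 1); split => //; first exact: ccont_cst.
by move=> w; rewrite mul1r addrC subrK.
Qed.

Lemma cderivD f g p a b :
  cderiv f p a -> cderiv g p b -> cderiv (fun w => f w + g w) p (a + b).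
Proof.
move=> [q [cq <- fE]] [r [cr <- gE]]; exists (fun w => q w + r w).
by split => [||w]; [exact: ccontD| |rewrite {1}fE {1}gE; ring].
Qed.

Lemma cderivN f p a : cderiv f p a -> cderiv (fun w => - f w) p (- a).
Proof.
move=> [q [cq <- fE]]; exists (fun w => - q w).
by split => [||w]; [exact: ccontN| |rewrite {1}fE; ring].
Qed.

Lemma cderivB f g p a b :
  cderiv f p a -> cderiv g p b -> cderiv (fun w => f w - g w) p (a - b).
Proof. by move=> ? ?; apply: cderivD => //; exact: cderivN. Qed.

Lemma cderivM f g p a b : cderiv f p a -> cderiv g p b ->
  cderiv (fun w => f w * g w) p (a * g p + f p * b).
Proof.
move=> df [r [cr <- gE]]; have cf := cderiv_ccont df.
have [q [cq <- fE]] := df; exists (fun w => q w * g p + f w * r w).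
split => [||w] //; last by rewrite gE mulrDr {1}(fE w); ring.
apply: ccontD; apply: ccontM => //; exact: ccont_cst.
Qed.

Lemma cderivZ a f p l : cderiv f p l -> cderiv (fun w => a * f w) p (a * l).
Proof.
move=> df; have := cderivM (cderiv_cst a p) df.
by rewrite mul0r add0r.
Qed.

Lemma cderivV f p a : f p != 0 -> cderiv f p a ->
  cderiv (fun w => (f w)^-1) p (- (a / f p ^+ 2)).
Proof.
move=> fp0 df; have cf := cderiv_ccont df.
have [q [cq <- fE]] := df.
have fn0 : \forall w \near p, f w != 0.
  move/ccontP : cf => /(_ (normc (f p))); rewrite normc_gt0 => /(_ fp0).
  apply: filterS => w; apply: contraTneq => ->.
  by rewrite sub0r normc_opp ltxx.
pose g w := (f p)^-1 + - (q w / (f w * f p)) * (cx w - cx p).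
have -> : - (q p / f p ^+ 2) = - (q p / (f p * f p)) by rewrite expr2.
apply: (@near_eq_cderiv g).
  apply: filterS fn0 => w fw0; rewrite /g.
  have h : q w * (cx w - cx p) = f w - f p by rewrite [f w]fE; ring.
  have -> : - (q w / (f w * f p)) * (cx w - cx p) =
     - (q w * (cx w - cx p)) / (f w * f p) by ring.
  by rewrite h; field; rewrite fw0.
exists (fun w => - (q w / (f w * f p))); split => //.
  apply: ccontN; apply: ccontM => //; apply: ccontV; first by rewrite mulf_neq0.
  by apply: ccontM => //; exact: ccont_cst.
by move=> w; rewrite /g subrr mulr0 addr0.
Qed.

Lemma cderivX f p a n : cderiv f p a ->
  exists l, cderiv (fun w => f w ^+ n) p l.
Proof.
move=> df; elim: n => [|n [l dl]].
  by exists 0; under [X in cderiv X]eq_fun do rewrite expr0; exact: cderiv_cst.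
exists (a * f p ^+ n + f p * l).
by under [X in cderiv X]eq_fun do rewrite exprS; exact: cderivM.
Qed.

(** Complex derivatives survive an anticonformal change of variable followed by
    conjugation: this is what makes Schwarz reflection holomorphic. *)
Lemma cderiv_reflect f s p a b :
  cderiv f (pt (conjc (s p))) a -> cderiv s p b ->
  cderiv (fun w => conjc (f (pt (conjc (s w))))) p (conjc a * b).
Proof.
move=> [q [cq <- fE]] ds; have cs := cderiv_ccont ds.
have [r [cr <- sE]] := ds.
exists (fun w => conjc (q (pt (conjc (s w)))) * r w); split => //.
  apply: ccontM => //; apply: ccontJ; apply: ccont_comp => //.
  by apply: continuous_pt; exact: ccontJ.
move=> w; rewrite {1}fE !ptK rmorphD rmorphM -rmorphB /= conjcK.
have -> : s w - s p = r w * (cx w - cx p) by rewrite {1}(sE w); ring.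
by rewrite mulrA.
Qed.

Lemma cderiv_unique f p a b : cderiv f p a -> cderiv f p b -> a = b.
Proof.
move=> /cderivP da /cderivP db; apply/eqP; rewrite -subr_eq0 -normc_eq0.
rewrite eq_le normc_ge0 andbT; apply/ler_addgt0Pr => e e0; rewrite add0r.
have e2 : 0 < e / 2 by rewrite divr_gt0.
have : \forall w \near p, normc ((a - b) * (cx w - cx p)) <=
    e * normc (cx w - cx p).
  have := db _ e2; have := da _ e2; apply: filterS2 => w ha hb.
  have -> : (a - b) * (cx w - cx p) =
    (f w - f p - b * (cx w - cx p)) - (f w - f p - a * (cx w - cx p)) by ring.
  by apply: le_trans (le_normc_sub _ _) _; rewrite [e]splitr mulrDl lerD.
move/near_discP => [r r0 H]; have r2 : 0 < r / 2 by rewrite divr_gt0.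
have := H (pt (cx p + (r / 2)%:C%C)).
rewrite ptK addrAC subrr add0r normcrM normc_real (gtr0_norm r2) ler_pM2r //.
by apply; rewrite ltr_pdivrMr // ltr_pMr // ltr1n.
Qed.

Lemma is_derive_cvg (V : normedModType R) (u : V -> R) (x v : V) (l : R) :
  h^-1 *: (u (h *: v + x) - u x) @[h --> 0^'] --> l -> is_derive x v u l.
Proof.
move=> h; split; first by apply/cvg_ex; exists l.
by apply/cvg_lim.
Qed.

Section PointwiseRules.
Context {V : normedModType R}.
Implicit Types (u t : V -> R) (x v : V) (d e : R).

Lemma is_derive_sum u t x v d e : is_derive x v u d -> is_derive x v t e ->
  is_derive x v (fun y => u y + t y) (d + e).
Proof. exact: is_deriveD. Qed.
Lemma is_derive_diff u t x v d e : is_derive x v u d -> is_derive x v t e ->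
  is_derive x v (fun y => u y - t y) (d - e).
Proof. exact: is_deriveB. Qed.
Lemma is_derive_prod u t x v d e : is_derive x v u d -> is_derive x v t e ->
  is_derive x v (fun y => u y * t y) (u x * e + t x * d).
Proof. exact: is_deriveM. Qed.

End PointwiseRules.

Definition line p (k : C) (t : R) : P := pt (cx p + t%:C%C * k).

Lemma line0 p k : line p k 0 = p.
Proof. by rewrite /line mul0r addr0 cxK. Qed.

Lemma cx_line p k t : cx (line p k t) = cx p + t%:C%C * k.
Proof. by rewrite ptK. Qed.

Lemma cderiv_quotient f p l k : cderiv f p l ->
  h^-1 * (re (f (line p k h)) - re (f p)) @[h --> (0 : R)^'] --> re (l * k).
Proof.
move=> [q [cq <- fE]].
have cl : line p k h @[h --> (0 : R)^'] --> p.
  rewrite -[X in _ --> X](cxK p) /cx /pt /=.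
  rewrite (_ : line p k = fun h => (p.1 + h * re k, p.2 + h * im k)); last first.
    by apply/funext => h; rewrite /line /pt !riE !mul0r subr0 addr0.
  have H x (y : R) : x + h * y @[h --> (0 : R)^'] --> x.
    rewrite -[X in _ --> X]addr0 -[X in _ + X](mul0r y).
    apply: cvgD; first exact: cvg_cst.
    apply: cvgM; last exact: cvg_cst.
    by move=> A /nbhs_dnbhs.
  exact: (cvg_pair (H _ _) (H _ _)).
have : re (q (line p k h) * k) @[h --> (0 : R)^'] --> re (q p * k).
  have [cq1 cq2] : ccont (fun w => q w * k) p.
    by apply: ccontM => //; exact: ccont_cst.
  exact: (cvg_comp _ (fun w => re (q w * k)) cl cq1).
apply: cvg_trans; apply: near_eq_cvg.
near=> h.
have h0 : h != 0 by near: h; exact: nbhs_dnbhs_neq.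
rewrite -reN -reD [f (line _ _ _)]fE cx_line.
have -> : f p + q (line p k h) * (cx p + h%:C%C * k - cx p) - f p =
  h%:C%C * (q (line p k h) * k) by ring.
by rewrite [in RHS]reM !riE mul0r subr0 mulKf.
Unshelve. all: by end_near. Qed.

Lemma cderiv_is_derive f p l (v : P) :
  cderiv f p l -> is_derive p v (fun w => re (f w)) (re (l * cx v)).
Proof.
move=> df; apply: is_derive_cvg.
rewrite [X in X @ _ --> _](_ : _ = fun h =>
  h^-1 * (re (f (line p (cx v) h)) - re (f p))); first exact: cderiv_quotient.
apply/funext => h; congr (_ * (re (f _) - _)).
by case: p v {df} => ? ? [? ?]; rewrite /line /pt !riE /= !mul0r subr0 addr0; congr pair; exact: addrC.
Qed.

Lemma is_derive_line f p k l t : cderiv f (line p k t) l ->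
  is_derive t (1 : R) (fun s => re (f (line p k s))) (re (l * k)).
Proof.
move=> df; apply: is_derive_cvg.
rewrite [X in X @ _ --> _](_ : _ = fun h =>
  h^-1 * (re (f (line (line p k t) k h)) - re (f (line p k t))));
  first exact: cderiv_quotient.
apply/funext => h; congr (_ * (re (f _) - _)).
by rewrite /line ptK scaler1 rmorphD mulrDl; congr pt; ring.
Qed.

(** The second-order mean value inequality: a first derivative close to
    [A + t B] along a segment integrates to a Taylor estimate.  With [B = 0] it
    is the usual mean value inequality. *)
Lemma mean_value f f1 p k A B (d : R) : 0 <= d ->
  (forall t : R, 0 <= t <= 1 -> cderiv f (line p k t) (f1 (line p k t))) ->
  (forall t : R, 0 <= t <= 1 -> normc (f1 (line p k t) - A - t%:C%C * B) <= d) ->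
  normc (f (line p k 1) - f p - A * k - B / 2 * k) <= d * normc k.
Proof.
move=> d0 df f1d; apply: normc_le_re => [|c]; first by rewrite mulr_ge0 ?normc_ge0.
pose phi (t : R) := re (c * f (line p k t)) - t * re (c * (A * k))
  - t * (t * re (c * (B * k) / 2)).
pose dphi (t : R) := re (c * f1 (line p k t) * k) - re (c * (A * k))
  - t * re (c * (B * k)).
have dphiP (t : R) : 0 <= t <= 1 -> is_derive t (1 : R) phi (dphi t).
  move=> t01; rewrite /phi.
  have h1 := is_derive_line (cderivZ c (df t t01)).
  have h2 := @is_derive_id R _ t 1.
  have h3 := is_derive_prod h2 (is_derive_cst (re (c * (A * k))) t (1:R)).
  have h4 := is_derive_prod h2
    (is_derive_prod h2 (is_derive_cst (re (c * (B * k) / 2)) t (1:R))).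
  apply: (is_derive_eq (is_derive_diff (is_derive_diff h1 h3) h4)).
  rewrite /dphi !mulr0 !add0r !mulr1; congr (_ - _ - _).
  by rewrite [X in _ = _ * re X]splitr [in RHS]reD mulrDr.
have cphi : {within `[0 : R, 1]%classic, continuous phi}.
  apply: derivable_within_continuous => x; rewrite in_itv /= => x01.
  by have := dphiP x x01; exact: @ex_derive.
have [|xi xi01] := @MVT R phi dphi 0 1 ltr01 _ cphi.
  by move=> x; rewrite in_itv /= => /andP[x0 x1]; apply: dphiP; rewrite !ltW.
move: xi01; rewrite in_itv /= => /andP[/ltW x0 /ltW x1].
rewrite /phi subr0 mulr1 !mul0r !subr0 !mul1r line0.
have xi01 : 0 <= xi <= 1 by rewrite x0.
set lhs := (X in X = _ -> _); set rhs := (X in X <= _).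
have -> : rhs = lhs.
  rewrite /rhs /lhs -!reN -!reD; congr (re _); ring.
move=> ->.
have -> : dphi xi = re (c * k * (f1 (line p k xi) - A - xi%:C%C * B)).
  rewrite /dphi; have -> : xi * re (c * (B * k)) = re (xi%:C%C * (c * (B * k))).
    by rewrite [in RHS]reM !riE mul0r subr0.
  by rewrite -!reN -!reD; congr (re _); ring.
apply: (le_trans (ler_norm _)); apply: (le_trans (re_le_normc _)).
rewrite !normcrM -mulrA ler_wpM2l ?normc_ge0 //.
by rewrite mulrC ler_wpM2r ?normc_ge0 // f1d.
Qed.

End ComplexDerivative.

(** * The maximum principle *)

Section MaximumPrinciple.
Context {R : realType}.
Local Notation P := (R * R)%type.
Local Notation C := R[i].
Local Notation re := (@complex.Re R).
Local Notation im := (@complex.Im R).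
Implicit Types (p w z : P) (a b l k A B : C) (f g : P -> C) (V K : set P).

Definition cdiff f p := exists l, cderiv f p l.
(** Twice complex differentiable at [p]: the regularity from which the maximum
    principle is proved, and from which all further regularity follows. *)
Definition twice f p := exists2 f1 : P -> C,
  (\forall w \near p, cderiv f w (f1 w)) & cdiff f1 p.
Definition translate p k : P := pt (cx p + k).
Definition cdisc w (r : R) : set P := [set z | normc (cx z - cx w) <= r].

Lemma cx_translate p k : cx (translate p k) = cx p + k. Proof. exact: ptK. Qed.
Lemma translateBK p z : translate p (cx z - cx p) = z.
Proof. by rewrite /translate addrC subrK cxK. Qed.
Lemma line1 p k : line p k 1 = translate p k.
Proof. by rewrite /line mul1r. Qed.

Lemma near_all p (Q : P -> Prop) : (forall w, Q w) -> \forall w \near p, Q w.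
Proof. by move=> h; apply: (@filterS _ (nbhs p) _ setT) => [w _|]; [exact: h|exact: filterT]. Qed.

Lemma near_near p (Q : P -> Prop) : (\forall w \near p, Q w) ->
  \forall w \near p, \forall w' \near w, Q w'.
Proof. by move=> h; exact: nbhs_interior. Qed.

Lemma twice_ccont f p : twice f p -> ccont f p.
Proof. by move=> [f1 /nbhs_singleton df _]; exact: cderiv_ccont df. Qed.

Lemma near_eq_twice f g p : (\forall w \near p, f w = g w) ->
  twice f p -> twice g p.
Proof.
move=> fg [f1 df d2]; exists f1 => //.
have := near_near fg; apply: (@filterS2 _ (nbhs p) _ _ _ _ _ df) => w df1 fg1.
exact: near_eq_cderiv df1.
Qed.

Lemma twice_cst a p : twice (fun=> a) p.
Proof.
exists (fun=> 0); first by apply: near_all => w; exact: cderiv_cst.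
by exists 0; exact: cderiv_cst.
Qed.

Lemma twice_cx p : twice cx p.
Proof.
exists (fun=> 1); first by apply: near_all => w; exact: cderiv_cx.
by exists 0; exact: cderiv_cst.
Qed.

Lemma twiceD f g p : twice f p -> twice g p -> twice (fun w => f w + g w) p.
Proof.
move=> [f1 df [l dl]] [g1 dg [m dm]]; exists (fun w => f1 w + g1 w).
  by move: df dg; apply: filterS2 => w; exact: cderivD.
by exists (l + m); exact: cderivD.
Qed.

Lemma twiceN f p : twice f p -> twice (fun w => - f w) p.
Proof.
move=> [f1 df [l dl]]; exists (fun w => - f1 w).
  by move: df; apply: filterS => w; exact: cderivN.
by exists (- l); exact: cderivN.
Qed.

Lemma twiceB f g p : twice f p -> twice g p -> twice (fun w => f w - g w) p.
Proof. by move=> ? ?; apply: twiceD => //; exact: twiceN. Qed.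

Lemma twiceM f g p : twice f p -> twice g p -> twice (fun w => f w * g w) p.
Proof.
move=> [f1 df [l dl]] [g1 dg [m dm]].
exists (fun w => f1 w * g w + f w * g1 w).
  by move: df dg; apply: filterS2 => w; exact: cderivM.
move: df dg => /nbhs_singleton df /nbhs_singleton dg.
eexists; apply: cderivD; apply: cderivM; eassumption.
Qed.

Lemma twiceX f p n : twice f p -> twice (fun w => f w ^+ n) p.
Proof.
move=> tf; elim: n => [|n IH].
  by under [X in twice X]eq_fun do rewrite expr0; exact: twice_cst.
by under [X in twice X]eq_fun do rewrite exprS; exact: twiceM.
Qed.

Lemma ccont_neq0 f p : ccont f p -> f p != 0 -> \forall w \near p, f w != 0.
Proof.
move=> /ccontP + fp0; move=> /(_ (normc (f p))); rewrite normc_gt0 => /(_ fp0).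
apply: filterS => w; apply: contraTneq => ->.
by rewrite sub0r normc_opp ltxx.
Qed.

Lemma twiceV f p : f p != 0 -> twice f p -> twice (fun w => (f w)^-1) p.
Proof.
move=> fp0 tf; have nf := ccont_neq0 (twice_ccont tf) fp0.
move: tf => [f1 df [l dl]].
exists (fun w => - (f1 w * (f w ^+ 2)^-1)).
  by move: df nf; apply: filterS2 => w df nf; exact: cderivV.
move: df => /nbhs_singleton df; have [m dm] := cderivX 2 df.
eexists; apply/cderivN/cderivM; first exact: dl.
by apply: cderivV; [rewrite expf_neq0|exact: dm].
Qed.

Lemma cderiv_translate f k p l :
  cderiv f (translate p k) l -> cderiv (fun w => f (translate w k)) p l.
Proof.
move=> [q [cq <- fE]]; exists (fun w => q (translate w k)); split => //.
  apply: ccont_comp => //; apply: continuous_pt.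
  by apply: ccontD; [exact: ccont_cx|exact: ccont_cst].
by move=> w; rewrite fE !cx_translate; congr (_ + _ * _); ring.
Qed.

Lemma near_translate k p (Q : P -> Prop) :
  (\forall w \near translate p k, Q w) -> \forall w \near p, Q (translate w k).
Proof.
have : translate w k @[w --> p] --> translate p k.
  apply: continuous_pt.
  by apply: ccontD; [exact: ccont_cx|exact: ccont_cst].
by move=> h Qk; exact: h.
Qed.

Lemma twice_translate f k p : twice f (translate p k) -> twice (fun w => f (translate w k)) p.
Proof.
move=> [f1 df [l dl]]; exists (fun w => f1 (translate w k)).
  by move/near_translate : df; apply: filterS => w; exact: cderiv_translate.
by exists l; exact: cderiv_translate.
Qed.

Lemma taylor2 f p : twice f p -> exists A B, forall d : R, 0 < d ->
  exists2 r : R, 0 < r & forall k, normc k < r ->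
  normc (f (translate p k) - f p - A * k - B * k ^+ 2) <= d * normc k ^+ 2.
Proof.
move=> [f1 df [l dl]]; exists (f1 p), (l / 2) => d d0.
have := (cderivP _ _ _).1 dl _ d0; move: df => /filterI h /h{h} /near_discP[r r0 H].
exists r => // k kr.
have Lr (t : R) : 0 <= t <= 1 -> normc (cx (line p k t) - cx p) < r.
  move=> /andP[t0 t1]; rewrite cx_line addrAC subrr add0r normcrM normc_real.
  by rewrite ger0_norm //; apply: le_lt_trans kr; rewrite ler_piMl ?normc_ge0.
have := @mean_value _ f f1 p k (f1 p) (l * k) (d * normc k).
rewrite line1 [normc k ^+ 2]expr2 [d * (_ * _)]mulrA.
have -> : l / 2 * k ^+ 2 = l * k / 2 * k by ring.
apply; first by rewrite mulr_ge0 ?normc_ge0 // ltW.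
  by move=> t t01; have [] := H _ (Lr t t01).
move=> t t01; have [_] := H _ (Lr t t01).
have -> : cx (line p k t) - cx p = t%:C%C * k.
  by rewrite cx_line addrAC subrr add0r.
have -> : l * (t%:C%C * k) = t%:C%C * (l * k) by ring.
move=> /le_trans; apply; rewrite ler_wpM2l ?(ltW d0) // normcrM normc_real.
by case/andP: t01 => t0 t1; rewrite ger0_norm // ler_piMl ?normc_ge0.
Qed.

Let i : C := 'i%C.
Lemma mulii : i * i = -1. Proof. by rewrite -expr2 sqr_i. Qed.

Lemma normc_i : normc i = 1.
Proof. by rewrite normcE /= expr0n add0r expr1n sqrtr1. Qed.

Lemma four_point_sqr a (h : R) :
  normc (a + (h%:C)%C) ^+ 2 + normc (a - (h%:C)%C) ^+ 2 +
  normc (a + i * (h%:C)%C) ^+ 2 + normc (a - i * (h%:C)%C) ^+ 2 =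
  4 * normc a ^+ 2 + 4 * h ^+ 2.
Proof.
have -> : i * (h%:C)%C = (0 +i* h)%C.
  by apply: complex_eq; rewrite [LHS](reM, imM) /= ?mul0r ?mul1r ?subr0 ?add0r.
have -> : (h%:C)%C = (h +i* 0)%C by [].
case: a => x y; rewrite !sqr_normc !(reD, imD, reN, imN).
rewrite [re (0 +i* h)%C]/= [im (0 +i* h)%C]/= [re (h +i* 0)%C]/= [im (h +i* 0)%C]/=.
rewrite [re (x +i* y)%C]/= [im (x +i* y)%C]/=; ring.
Qed.

(** In the mean over the four points [p + i^j h] the first- and second-order
    terms of a holomorphic function cancel. *)
Lemma four_point_mean f p : twice f p -> forall d : R, 0 < d ->
  exists2 r : R, 0 < r & forall h : R, 0 < h < r ->
  normc (f (translate p (h%:C)%C) + f (translate p (- (h%:C)%C)) +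
         f (translate p (i * (h%:C)%C)) + f (translate p (- (i * (h%:C)%C)))
         - 4 * f p) <= d * h ^+ 2.
Proof.
move=> /taylor2[A [B T]] d d0.
have d4 : 0 < d / 4 by rewrite divr_gt0.
have [r r0 H] := T _ d4; exists r => // h /andP[h0 hr].
set k : C := (h%:C)%C.
have nk : normc k = h by rewrite normc_real gtr0_norm.
have nik : normc (i * k) = h by rewrite normcrM normc_i mul1r.
have h1 := H k; have h2 := H (- k); have h3 := H (i * k); have h4 := H (- (i * k)).
rewrite !normc_opp nk nik in h1 h2 h3 h4.
have {}h1 := h1 hr; have {}h2 := h2 hr; have {}h3 := h3 hr; have {}h4 := h4 hr.
set e1 := (X in normc X <= _) in h1; set e2 := (X in normc X <= _) in h2.
set e3 := (X in normc X <= _) in h3; set e4 := (X in normc X <= _) in h4.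
set S := (X in normc X).
have -> : S = e1 + e2 + e3 + e4.
  have e : B * (i * k) ^+ 2 = - (B * k ^+ 2).
    by rewrite exprMn [i ^+ 2]expr2 mulii mulN1r mulrN.
  by rewrite /S /e1 /e2 /e3 /e4 !sqrrN e; ring.
apply: (le_trans (le_normc_add _ _)).
apply: (le_trans (lerD (le_normc_add _ _) (lexx _))).
apply: (le_trans (lerD (lerD (le_normc_add _ _) (lexx _)) (lexx _))).
have -> : d * h ^+ 2 = d / 4 * h ^+ 2 + d / 4 * h ^+ 2 + d / 4 * h ^+ 2 + d / 4 * h ^+ 2.
  by field.
by rewrite !lerD.
Qed.

(** Adding a small multiple of the strictly subharmonic
    function [|z|^2] to the real part of a multiple of [f] rules out an interior
    maximum by comparison with a four-point mean.  The first alternative covers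
    boundary points as well as points where [f] is small but need not be
    differentiable, such as removable singularities with value 0. *)
Lemma max_modulus K f (M : R) : 0 <= M -> compact K -> (forall z, K z -> ccont f z) ->
  (forall z, K z -> normc (f z) <= M \/ nbhs z K /\ twice f z) ->
  forall z, K z -> normc (f z) <= M.
Proof.
move=> M0 cK cf alt p0 Kp0; rewrite leNgt; apply/negP => Mp0.
pose c := conjc (f p0).
have c0 : 0 < normc c by rewrite normc_conj (le_lt_trans M0).
have K0 : K !=set0 by exists p0.
have cN z : normc (cx w) @[w --> z] --> normc (cx z) := ccont_normc (ccont_cx z).
have [b _ bK] : exists2 b, b \in K & forall t, t \in K -> normc (cx t) <= normc (cx b).
  by apply: compact_EVT_max => //; apply: continuous_in_subspaceT => z _; exact: cN.
pose Bd := normc (cx b) ^+ 2 + 1.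
have Bd0 : 0 < Bd by rewrite ltr_wpDl ?sqr_ge0.
have KBd z : K z -> normc (cx z) ^+ 2 <= Bd.
  move=> Kz; rewrite ler_wpDr // ler_sqr ?nnegrE ?normc_ge0 //.
  by apply: bK; rewrite inE.
pose gap := normc c * (normc (f p0) - M).
have gap0 : 0 < gap by rewrite mulr_gt0 // subr_gt0.
pose e := gap / (2 * Bd).
have e0 : 0 < e by rewrite divr_gt0 // mulr_gt0.
have eBd : e * Bd = gap / 2 by rewrite /e; field; rewrite gt_eqF.
pose u z := re (c * f z) + e * normc (cx z) ^+ 2.
have cu z : K z -> u w @[w --> z] --> u z.
  move=> Kz; apply: cvgD.
    by case: (ccontM (ccont_cst c z) (cf _ Kz)).
  apply: cvgM; first exact: cvg_cst.
  by under eq_fun do rewrite expr2; rewrite expr2; apply: cvgM; exact: cN.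
have [p1 /set_mem Kp1 p1K] : exists2 p1, p1 \in K & forall t, t \in K -> u t <= u p1.
  by apply: compact_EVT_max => //; apply: continuous_in_subspaceT => z /set_mem; exact: cu.
have up1 : normc c * normc (f p0) <= u p1.
  have := p1K p0; rewrite inE => /(_ Kp0); apply: le_trans.
  have -> : normc c * normc (f p0) = re (c * f p0).
    by rewrite /c normc_conj -[LHS]expr2 sqr_normc !riE; ring.
  by rewrite /u lerDl mulr_ge0 ?sqr_ge0 // ltW.
(* [e] is so small that [u] cannot be maximal where [f] is bounded by [M]. *)
case: (alt _ Kp1) => [fM|[nK tf]].
  have : u p1 <= normc c * M + gap / 2.
    rewrite /u -eBd lerD ?ler_wpM2l ?KBd ?(ltW e0) //.
    apply: (le_trans (ler_norm _)); apply: (le_trans (re_le_normc _)).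
    by rewrite normcrM ler_wpM2l // ltW.
  move=> /(le_trans up1).
  have -> : normc c * normc (f p0) = normc c * M + gap by rewrite /gap; ring.
  by rewrite lerD2l leNgt ltr_pdivrMr // ltr_pMr // ltr1n.
(* At an interior maximum the mean of [u] over four points at distance [h] exceeds
   [u p1] by [e * h ^ 2], up to an error that is small compared with [h ^ 2]. *)
have d0 : 0 < e / normc c by rewrite divr_gt0.
have [r r0 Hr] := four_point_mean tf d0.
have [s s0 Ks] := (near_discP _ _).1 nK.
pose h := Num.min r s / 2.
have h0 : 0 < h by rewrite divr_gt0 // lt_min r0.
have hr : h < r.
  rewrite /h ltr_pdivrMr //; apply: (@le_lt_trans _ _ r).
    by rewrite ge_min lexx ?orbT.
  by rewrite ltr_pMr // ltr1n.
have hs : h < s.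
  rewrite /h ltr_pdivrMr //; apply: (@le_lt_trans _ _ s).
    by rewrite ge_min lexx ?orbT.
  by rewrite ltr_pMr // ltr1n.
have := Hr h; rewrite h0 hr => /(_ isT).
set k : C := (h%:C)%C.
have nk : normc k = h by rewrite normc_real gtr0_norm.
have uk a : normc a = h -> u (translate p1 a) <= u p1.
  move=> ah; apply: p1K; rewrite inE; apply: Ks.
  by rewrite cx_translate addrAC subrr add0r ah.
have nik : normc (i * k) = h by rewrite normcrM normc_i mul1r.
have := uk k nk; have := uk (- k); rewrite normc_opp => /(_ nk).
have := uk (i * k) nik; have := uk (- (i * k)); rewrite normc_opp => /(_ nik).
rewrite /u !cx_translate.
set f1 := f (translate p1 k); set f2 := f (translate p1 (- k)).
set f3 := f (translate p1 (i * k)); set f4 := f (translate p1 (- (i * k))).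
move=> u4 u3 u2 u1 mean.
have sq : normc (cx p1 + k) ^+ 2 + normc (cx p1 - k) ^+ 2 +
    normc (cx p1 + i * k) ^+ 2 + normc (cx p1 - i * k) ^+ 2 =
    4 * normc (cx p1) ^+ 2 + 4 * h ^+ 2.
  exact: four_point_sqr.
have : - re (c * (f1 + f2 + f3 + f4 - 4 * f p1)) <= e * h ^+ 2.
  rewrite -reN; apply: (le_trans (ler_norm _)); apply: (le_trans (re_le_normc _)).
  rewrite normc_opp normcrM.
  have -> : e * h ^+ 2 = normc c * (e / normc c * h ^+ 2) by field; rewrite gt_eqF.
  by rewrite ler_wpM2l // ltW.
have -> : re (c * (f1 + f2 + f3 + f4 - 4 * f p1)) =
  re (c * f1) + re (c * f2) + re (c * f3) + re (c * f4) - 4 * re (c * f p1).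
  have -> : c * (f1 + f2 + f3 + f4 - 4 * f p1) =
    c * f1 + c * f2 + c * f3 + c * f4 -
    (c * f p1 + c * f p1 + c * f p1 + c * f p1) by ring.
  by rewrite !(reD, reN); ring.
have h20 : 0 < e * h ^+ 2 by rewrite mulr_gt0 // exprn_gt0.
have := congr1 ( *%R e) sq; lra.
Qed.

End MaximumPrinciple.

(** * Cauchy estimates *)

Section Regularity.
Context {R : realType}.
Local Notation P := (R * R)%type.
Local Notation C := R[i].
Local Notation re := (@complex.Re R).
Local Notation im := (@complex.Im R).
Implicit Types (p w z : P) (a b l k A B : C) (f g : P -> C) (V K : set P).

Lemma cdiscE w r z : cdisc w r z = (normc (cx z - cx w) <= r) :> Prop.
Proof. by []. Qed.

Lemma compact_cdisc w r : compact (cdisc w r).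
Proof.
apply: (@subclosed_compact _ _
  (`[w.1 - r, w.1 + r]%classic `*` `[w.2 - r, w.2 + r]%classic)).
- rewrite (_ : cdisc w r = (fun z => normc (cx z - cx w)) @^-1` [set x | x <= r]) //.
  apply: preimage_closed; last exact: closed_le.
  move=> z _; apply: ccont_normc.
  by apply: ccontB; [exact: ccont_cx|exact: ccont_cst].
- by apply: compact_setX; exact: segment_compact.
- move=> z zr; rewrite /= !in_itv /=; rewrite cdiscE in zr.
  have := le_trans (re_le_normc _) zr; have := le_trans (im_le_normc _) zr.
  rewrite cxB_re cxB_im !ler_norml => /andP[? ?] /andP[? ?].
  by split; apply/andP; split; lra.
Qed.

Lemma nbhs_cdisc w r z : normc (cx z - cx w) < r -> nbhs z (cdisc w r).
Proof.
move=> zr; apply/near_discP; exists (r - normc (cx z - cx w)) => [|y].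
  by rewrite subr_gt0.
move=> yz; rewrite cdiscE; have -> : cx y - cx w = (cx y - cx z) + (cx z - cx w) by ring.
by apply: le_trans (le_normc_add _ _) _; rewrite -lerBrDr ltW.
Qed.

Lemma cdisc_center w r : 0 <= r -> cdisc w r w.
Proof. by move=> r0; rewrite !cdiscE subrr normcr0. Qed.

Lemma cdisc_sub w z r s t : cdisc w r z -> r + s <= t -> cdisc z s `<=` cdisc w t.
Proof.
rewrite cdiscE => zr rst y; rewrite !cdiscE => ys.
have -> : cx y - cx w = (cx z - cx w) + (cx y - cx z) by ring.
by apply: le_trans (le_normc_add _ _) _; apply: le_trans rst; rewrite lerD.
Qed.

(** A multiplicative constant is lost in the limit of large powers; this is how
    the maximum principle, applied to powers, yields sharp bounds. *)
Lemma le_of_powers (x a c : R) : 0 <= a -> 0 <= x ->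
  (forall n, x ^+ n * x <= c * a ^+ n) -> x <= a.
Proof.
move=> a0 x0 H; rewrite leNgt; apply/negP => ax.
have x_gt0 : 0 < x := le_lt_trans a0 ax.
have [a_eq0|a_neq0] := eqVneq a 0.
  have := H 1%N; rewrite a_eq0 expr1 expr1 mulr0 => /le_lt_trans -/(_ (x * x)).
  by rewrite mulr_gt0 // ltxx => /(_ isT).
have a_gt0 : 0 < a by rewrite lt0r a_neq0.
pose e := x / a - 1.
have e0 : 0 < e by rewrite subr_gt0 ltr_pdivlMr // mul1r.
have bern n : 1 + n%:R * e <= (x / a) ^+ n.
  elim: n => [|n IH]; first by rewrite mul0r addr0 expr0.
  have xa0 : 0 <= x / a by rewrite divr_ge0.
  rewrite exprS; apply: le_trans (ler_wpM2l xa0 IH).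
  have -> : x / a = 1 + e by rewrite /e addrC subrK.
  have -> : (1 + e) * (1 + n%:R * e) = 1 + n.+1%:R * e + n%:R * e ^+ 2.
    by rewrite -natr1; ring.
  by rewrite lerDl mulr_ge0 ?ler0n ?sqr_ge0.
have ub n : 1 + n%:R * e <= c / x.
  apply: le_trans (bern n) _; rewrite ler_pdivlMr // expr_div_n mulrAC.
  by rewrite ler_pdivrMr ?exprn_gt0.
have := truncnS_gt (c / x / e); rewrite ltr_pdivrMr // => /lt_le_trans.
move=> /(_ _ (le_trans (ler_wpDl ler01 (lexx _)) (ub _))); rewrite ltxx.
by [].
Qed.

(** The Schwarz-type bound behind Cauchy's estimate.  The quotient
    [q = (f - f w) / (z - w)] is only known to be continuous at [w], but
    [q ^+ n * (f - f w)] vanishes there, so it obeys the maximum principle;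
    letting [n] grow recovers the bound for [q] itself. *)
Lemma cauchy_lipschitz f w (rho M : R) : 0 < rho ->
  (forall z, cdisc w rho z -> twice f z) ->
  (forall z, cdisc w rho z -> normc (f z) <= M) ->
  forall z, cdisc w rho z ->
  normc (f z - f w) <= 2 * M / rho * normc (cx z - cx w).
Proof.
move=> r0 tf fM z Kz; have Kw := cdisc_center w (ltW r0).
have M0 : 0 <= M := le_trans (normc_ge0 _) (fM _ Kw).
have [f1 /nbhs_singleton [q [cq _ fE]] _] := tf _ Kw.
have fB y : f y - f w = q y * (cx y - cx w) by rewrite fE; ring.
have f2M y : cdisc w rho y -> normc (f y - f w) <= 2 * M.
  move=> Ky; apply: le_trans (le_normc_sub _ _) _.
  by rewrite mulr_natl mulr2n lerD //; exact: fM.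
have tq y : cdisc w rho y -> y != w -> twice q y.
  move=> Ky yw; have n0 : cx y - cx w != 0 by rewrite cxB_eq0.
  have cw := twiceB (twice_cx y) (twice_cst (cx w) y).
  apply: near_eq_twice (twiceM (twiceB (tf _ Ky) (twice_cst (f w) y)) (twiceV n0 cw)).
  by have := ccont_neq0 (twice_ccont cw) n0; apply: filterS => v v0; rewrite fB mulfK.
(* At the boundary the bound comes from [|q| <= 2 M / rho]. *)
have qM n : forall y, cdisc w rho y ->
    normc (q y ^+ n * (f y - f w)) <= (2 * M / rho) ^+ n * (2 * M).
  have tpsi y : cdisc w rho y -> y != w -> twice (fun v => q v ^+ n * (f v - f w)) y.
    move=> Ky yw; apply: twiceM; first exact/twiceX/tq.
    exact: twiceB (tf _ Ky) (twice_cst _ _).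
  have b0 : 0 <= 2 * M / rho by apply: divr_ge0; [rewrite mulr_ge0 ?ler0n|exact: ltW].
  apply: max_modulus; first by rewrite mulr_ge0 ?exprn_ge0 // mulr_ge0 ?ler0n.
  - exact: compact_cdisc.
  - move=> y Ky; have [->|yw] := eqVneq y w; last exact/twice_ccont/tpsi.
    apply: ccontM; first exact: ccontX.
    by apply: ccontB; [exact/twice_ccont/tf|exact: ccont_cst].
  - move=> y Ky; have [->|yw] := eqVneq y w.
      by left; rewrite subrr mulr0 normcr0 mulr_ge0 ?exprn_ge0 // mulr_ge0 ?ler0n.
    have [yr|ry] := ltP (normc (cx y - cx w)) rho.
      by right; split; [exact: nbhs_cdisc|exact: tpsi].
    left; rewrite normcrM normc_exp ler_pM ?exprn_ge0 ?normc_ge0 ?f2M //.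
    rewrite lerXn2r ?nnegrE ?normc_ge0 // ler_pdivlMr //.
    apply: le_trans (f2M _ Ky); rewrite fB normcrM.
    by rewrite ler_wpM2l ?normc_ge0.
apply: (@le_of_powers _ _ (2 * M)); rewrite ?mulr_ge0 ?normc_ge0 ?invr_ge0 // ?ltW //.
move=> n; have := qM n z Kz; rewrite normcrM normc_exp => h.
have xE : normc (f z - f w) = normc (q z) * normc (cx z - cx w).
  by rewrite fB normcrM.
rewrite {1}xE exprMn mulrAC exprMn mulrA [2 * M * _]mulrC.
by apply: ler_wpM2r; rewrite ?exprn_ge0 ?normc_ge0.
Qed.

Lemma cderiv_le f w l (L : R) : cderiv f w l ->
  (\forall z \near w, normc (f z - f w) <= L * normc (cx z - cx w)) -> normc l <= L.
Proof.
move=> /cderivP df fL; apply/ler_addgt0Pr => e e0.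
have := df _ e0; move: fL => /filterI h /h{h} /near_discP[r r0 H].
have r2 : 0 < r / 2 by rewrite divr_gt0.
have Ez : cx (translate w (r / 2)%:C%C) - cx w = (r / 2)%:C%C.
  by rewrite cx_translate addrAC subrr add0r.
have [] := H (translate w (r / 2)%:C%C).
  by rewrite Ez normc_real gtr0_norm // ltr_pdivrMr // ltr_pMr // ltr1n.
set z := translate _ _; rewrite Ez => h1 h2.
have : normc (l * (r / 2)%:C%C) <= (L + e) * (r / 2).
  have -> : l * (r / 2)%:C%C = (f z - f w) - (f z - f w - l * (r / 2)%:C%C) by ring.
  rewrite normc_real gtr0_norm // in h1 h2.
  by apply: le_trans (le_normc_sub _ _) _; rewrite mulrDl lerD.
by rewrite normcrM normc_real gtr0_norm // ler_pM2r.
Qed.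

(** The same estimate applied to the difference quotients of [f] bounds the
    increments of the derivative. *)
Lemma cauchy_lipschitz_deriv f w (rho M : R) k a b : 0 < rho ->
  (forall z, cdisc w (rho + rho) z -> twice f z) ->
  (forall z, cdisc w (rho + rho) z -> normc (f z) <= M) ->
  normc k <= rho -> cderiv f w a -> cderiv f (translate w k) b ->
  normc (b - a) <= 4 * M / rho ^+ 2 * normc k.
Proof.
move=> r0 tf fM kr da db.
have Kz z : cdisc w rho z -> cdisc w (rho + rho) z.
  by rewrite !cdiscE => /le_trans; apply; rewrite lerDl ltW.
have Kk z : cdisc w rho z -> cdisc w (rho + rho) (translate z k).
  rewrite !cdiscE cx_translate addrAC => zr.
  by apply: le_trans (le_normc_add _ _) _; rewrite lerD.
pose g z := f (translate z k) - f z.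
have gM z : cdisc w rho z -> normc (g z) <= 2 * M / rho * normc k.
  move=> zr; have := @cauchy_lipschitz f z rho M r0 _ _ (translate z k).
  rewrite cdiscE cx_translate addrAC subrr add0r; apply => // y yz;
    [apply: tf|apply: fM]; exact: (cdisc_sub zr _ yz).
have tg z : cdisc w rho z -> twice g z.
  by move=> zr; apply: twiceB; [exact/twice_translate/tf/Kk|exact/tf/Kz].
have dg : cderiv g w (b - a) := cderivB (cderiv_translate db) da.
apply: (cderiv_le dg).
have : nbhs w (cdisc w rho) by apply: nbhs_cdisc; rewrite subrr normcr0.
apply: filterS => z Kwz; have := cauchy_lipschitz r0 tg gM Kwz.
congr (_ <= _ * _); field; by rewrite gt_eqF.
Qed.

End Regularity.

(** * Regularity of holomorphic functions *)

Section HolomorphicFunctions.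
Context {R : realType}.
Local Notation P := (R * R)%type.
Local Notation C := R[i].
Local Notation re := (@complex.Re R).
Local Notation im := (@complex.Im R).
Implicit Types (p w z : P) (a b l k A B : C) (f g : P -> C) (V K : set P).

(** The complex derivative as a total function, arbitrary where it does not
    exist. *)
Definition cD f p : C := xget 0 [set l | cderiv f p l].

Lemma cD_cderiv f p l : cderiv f p l -> cD f p = l.
Proof.
move=> df; rewrite /cD; case: xgetP => [m _ /= dm|/(_ l) //].
exact: cderiv_unique dm df.
Qed.

Lemma cDP f p : cdiff f p -> cderiv f p (cD f p).
Proof. by move=> [l dl]; rewrite (cD_cderiv dl). Qed.

Lemma twice_cD f p : twice f p -> cderiv f p (cD f p).
Proof. by move=> [f1 /nbhs_singleton df _]; apply: cDP; exists (f1 p). Qed.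

Lemma twice_cD2 f p : twice f p -> cderiv (cD f) p (cD (cD f) p).
Proof.
move=> [f1 df [l dl]]; apply: cDP; exists l; apply: near_eq_cderiv dl.
by apply: filterS df => w /cD_cderiv ->.
Qed.

(** The intervals with centre [q k] and radius [e k] meet pairwise, hence have a
    common point.  This serves as the Cauchy criterion, with an explicit rate. *)
Lemma squeezed_value (T : Type) (D : set T) (q e : T -> R) : D !=set0 ->
  (forall k l : T, D k -> D l -> q k - q l <= e k + e l) ->
  exists L : R, forall k : T, D k -> `|q k - L| <= e k.
Proof.
move=> [k0 Dk0] H; pose S := [set q k - e k | k in D].
have S0 : S !=set0 by exists (q k0 - e k0); exists k0.
have Sub (l : T) : D l -> ubound S (q l + e l).
  by move=> Dl _ [k Dk <-]; have := H k l Dk Dl; lra.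
have hS : has_sup S by split => //; exists (q k0 + e k0); exact: Sub.
exists (sup S) => k Dk; rewrite ler_norml.
have h1 : q k - e k <= sup S by apply: sup_upper_bound => //; exists k.
have h2 : sup S <= q k + e k by apply: ge_sup => //; exact: Sub.
by apply/andP; split; lra.
Qed.

Lemma nonzero_small (r : R) : 0 < r ->
  exists k : C, k != 0 /\ normc k <= r.
Proof.
move=> r0; exists (r%:C)%C; rewrite normc_real gtr0_norm //; split => //.
by rewrite -normc_eq0 normc_real normr_eq0 gt_eqF.
Qed.

Lemma bounded_on_cdisc f w r : 0 <= r ->
  (forall z, cdisc w r z -> twice f z) ->
  exists2 M : R, 0 <= M & forall z, cdisc w r z -> normc (f z) <= M.
Proof.
move=> r0 tf.
have [b _ bM] : exists2 b, b \in cdisc w r &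
    forall t, t \in cdisc w r -> normc (f t) <= normc (f b).
  apply: compact_EVT_max; [by exists w; exact: cdisc_center|exact: compact_cdisc|].
  by apply: continuous_in_subspaceT => z /set_mem /tf /twice_ccont /ccont_normc.
exists (normc (f b)); first exact: normc_ge0.
by move=> z Kz; apply: bM; rewrite inE.
Qed.

(** The difference quotients of [f] converge to [f'] at a linear rate on a disc,
    so by Cauchy's estimates their second derivatives, which are the difference
    quotients of [f''], are Cauchy at the centre. *)
Lemma third_derivative f w (rho : R) : 0 < rho ->
  (forall z, cdisc w (4 * rho) z -> twice f z) -> cdiff (cD (cD f)) w.
Proof.
move=> r0 tf.
have [M M0 fM] := bounded_on_cdisc (mulr_ge0 (ler0n _ 4) (ltW r0)) tf.
set f1 := cD f; set f2 := cD f1.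
have r2 : rho + rho <= 4 * rho by lra.
have K24 z : cdisc w (rho + rho) z -> cdisc w (4 * rho) z.
  by rewrite !cdiscE => /le_trans; apply.
have K24k z k : cdisc w (rho + rho) z -> normc k <= rho -> cdisc w (4 * rho) (translate z k).
  rewrite !cdiscE cx_translate addrAC => zr kr.
  by apply: le_trans (le_normc_add _ _) _; lra.
have d1 z : cdisc w (4 * rho) z -> cderiv f z (f1 z) by move=> /tf /twice_cD.
have d2 z : cdisc w (4 * rho) z -> cderiv f1 z (f2 z) by move=> /tf /twice_cD2.
pose L := 4 * M / rho ^+ 2.
have L0 : 0 <= L by apply: divr_ge0; [apply: mulr_ge0|exact: sqr_ge0].
have lip1 z k : cdisc w (rho + rho) z -> normc k <= rho ->
    normc (f1 (translate z k) - f1 z) <= L * normc k.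
  move=> Kz kr.
  have sub : cdisc z (rho + rho) `<=` cdisc w (4 * rho).
    by apply: (cdisc_sub Kz); lra.
  apply: (@cauchy_lipschitz_deriv _ f z) => // [y /sub /tf|y /sub /fM| |] //.
    exact/d1/K24.
  exact/d1/K24k.
pose quo k z := (f (translate z k) - f z) / k.
have quoL z k : cdisc w (rho + rho) z -> normc k <= rho -> k != 0 ->
    normc (quo k z - f1 z) <= L * normc k.
  move=> Kz kr k0.
  have E (t : R) : line z k t = translate z (t%:C%C * k) by [].
  have tk (t : R) : 0 <= t <= 1 -> normc (t%:C%C * k) <= normc k.
    move=> /andP[t0 t1]; rewrite normcrM normc_real ger0_norm //.
    by rewrite ler_piMl ?normc_ge0.
  have := @mean_value _ f f1 z k (f1 z) 0 (L * normc k).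
  rewrite line1 !mul0r subr0 => h.
  have -> : quo k z - f1 z = (f (translate z k) - f z - f1 z * k) / k.
    by rewrite /quo; field.
  rewrite normc_div ler_pdivrMr ?normc_gt0 //; apply: h.
  - by rewrite mulr_ge0 ?normc_ge0.
  - move=> t t01; rewrite E; apply/d1/K24k => //.
    exact: le_trans (tk t t01) kr.
  - move=> t t01; rewrite E mulr0 subr0; apply: le_trans (lip1 _ _ Kz _) _.
      exact: le_trans (tk t t01) kr.
    by apply: ler_wpM2l => //; exact: tk.
pose Q k := (f2 (translate w k) - f2 w) / k.
pose c := 4 * L / rho ^+ 2.
have c0 : 0 <= c by apply: divr_ge0; [apply: mulr_ge0|exact: sqr_ge0].
have r_ge0 := ltW r0.
have Kw : cdisc w (rho + rho) w by apply: cdisc_center; lra.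
(* The difference of two quotients is small on a disc, hence so is its second
   derivative at the centre, which is [Q k - Q l]. *)
have QC k l : k != 0 /\ normc k <= rho -> l != 0 /\ normc l <= rho ->
    normc (Q k - Q l) <= c * normc k + c * normc l.
  move=> [k0 kr] [l0 lr].
  pose E z := quo k z - quo l z.
  pose E1 z := (f1 (translate z k) - f1 z) / k - (f1 (translate z l) - f1 z) / l.
  have dq g g1 h z : cderiv g z (g1 z) -> cderiv g (translate z h) (g1 (translate z h)) ->
      cderiv (fun z => (g (translate z h) - g z) / h) z ((g1 (translate z h) - g1 z) / h).
    move=> dg dgh; under [X in cderiv X]eq_fun do rewrite mulrC; rewrite mulrC.
    by apply/cderivZ/cderivB => //; exact: cderiv_translate.
  have tE z : cdisc w (rho + rho) z -> twice E z.
    move=> Kz; have tD h : normc h <= rho -> twice (quo h) z.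
      move=> hr; apply: twiceM; last exact: twice_cst.
      by apply: twiceB; [exact/twice_translate/tf/K24k|exact/tf/K24].
    by apply: twiceB; exact: tD.
  have dE z : cdisc w (rho + rho) z -> cderiv E z (E1 z).
    by move=> Kz; apply: cderivB; apply: dq; apply: d1; [exact: K24|exact: K24k|exact: K24|exact: K24k].
  have EM z : cdisc w (rho + rho) z -> normc (E z) <= L * (normc k + normc l).
    move=> Kz; have -> : E z = (quo k z - f1 z) - (quo l z - f1 z) by rewrite /E; ring.
    by apply: le_trans (le_normc_sub _ _) _; rewrite mulrDr lerD // quoL.
  have dE1 : cderiv E1 w (Q k - Q l).
    by apply: cderivB; apply: dq; apply: d2; [exact: K24|exact: K24k|exact: K24|exact: K24k].
  apply: (cderiv_le dE1).
  have : nbhs w (cdisc w rho) by apply: nbhs_cdisc; rewrite subrr normcr0.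
  apply: filterS => z; rewrite cdiscE => zr.
  have Kz : cdisc w (rho + rho) z by rewrite cdiscE (le_trans zr) // lerDl.
  have := @cauchy_lipschitz_deriv _ E w rho (L * (normc k + normc l)) (cx z - cx w) _ _ r0 tE EM zr (dE _ Kw).
  rewrite translateBK => /(_ _ (dE _ Kz)); congr (_ <= _ * _).
  by rewrite /c; ring.
pose D := [set k : C | k != 0 /\ normc k <= rho].
have D0 : D !=set0 by have [k ?] := nonzero_small r0; exists k.
have reQ k l : D k -> D l -> re (Q k) - re (Q l) <= c * normc k + c * normc l.
  move=> Dk Dl; rewrite -reN -reD.
  exact: le_trans (le_trans (ler_norm _) (re_le_normc _)) (QC k l Dk Dl).
have imQ k l : D k -> D l -> im (Q k) - im (Q l) <= c * normc k + c * normc l.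
  move=> Dk Dl; rewrite -imN -imD.
  exact: le_trans (le_trans (ler_norm _) (im_le_normc _)) (QC k l Dk Dl).
have [x xP] := squeezed_value D0 reQ; have [y yP] := squeezed_value D0 imQ.
exists (x +i* y)%C; apply/cderivP => e e0.
have c1 : 0 < 2 * c + 1 by have := c0; lra.
apply/near_discP; exists (Num.min rho (e / (2 * c + 1))).
  by rewrite lt_min r0 divr_gt0.
move=> z; rewrite lt_min => /andP[zr ze].
have [->|zw] := eqVneq z w; first by rewrite !subrr mulr0 subrr normcr0 mulr0.
set k := cx z - cx w.
have k0 : k != 0 by rewrite cxB_eq0.
have Dk : D k by split => //; exact: ltW.
have -> : f2 z - f2 w - (x +i* y)%C * k = (Q k - (x +i* y)%C) * k.
  by rewrite /Q translateBK; field.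
rewrite normcrM ler_wpM2r ?normc_ge0 //.
apply: le_trans (normc_le_add _) _; rewrite reD imD reN imN.
apply: le_trans (lerD (xP _ Dk) (yP _ Dk)) _.
move: ze; rewrite -/k ltr_pdivlMr // => ze.
have := normc_ge0 k; lra.
Qed.

Lemma twice_deriv f p : (\forall z \near p, twice f z) -> twice (cD f) p.
Proof.
move=> tf; exists (cD (cD f)); first by apply: filterS tf => w /twice_cD2.
have /near_discP[r r0 H] := tf; apply: (@third_derivative _ _ (r / 8)).
  by rewrite divr_gt0.
by move=> z; rewrite cdiscE => zr; apply: H; apply: le_lt_trans zr _; lra.
Qed.

Definition hol V f := forall p, V p -> twice f p.

Lemma open_near V p : open V -> V p -> \forall z \near p, V z.
Proof. by move=> oV Vp; apply: open_nbhs_nbhs; split. Qed.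

Lemma hol_near V f p : open V -> hol V f -> V p -> \forall z \near p, twice f z.
Proof. by move=> oV hf /(open_near oV); apply: filterS => z /hf. Qed.

Lemma hol_cD V f : open V -> hol V f -> hol V (cD f).
Proof. by move=> oV hf p Vp; apply/twice_deriv/(hol_near oV). Qed.

End HolomorphicFunctions.

(** * The identity theorem *)

Section IdentityTheorem.
Context {R : realType}.
Local Notation P := (R * R)%type.
Local Notation C := R[i].
Implicit Types (p w z : P) (a b l k : C) (f g : P -> C) (V D : set P) (s : seq P).

Lemma normc_prod (I : Type) (s : seq I) (F : I -> C) :
  normc (\prod_(i <- s) F i) = \prod_(i <- s) normc (F i).
Proof.
by apply: (big_morph (fun z : C => normc z)) => [a b|]; rewrite ?normcrM ?normcr1.
Qed.

Lemma twice_prod s p : twice (fun z => \prod_(q <- s) (cx z - cx q)) p.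
Proof.
elim: s => [|q s IH].
  by under [X in twice X]eq_fun do rewrite big_nil; exact: twice_cst.
under [X in twice X]eq_fun do rewrite big_cons.
by apply: twiceM => //; apply: twiceB; [exact: twice_cx|exact: twice_cst].
Qed.

Lemma prod_neq0 s z : (\prod_(q <- s) (cx z - cx q) != 0) = (z \notin s).
Proof.
elim: s => [|q s IH]; first by rewrite big_nil oner_eq0 in_nil.
by rewrite big_cons mulf_eq0 negb_or IH cxB_eq0 in_cons negb_or.
Qed.

(** A holomorphic function with many zeros near the centre of a disc is small on
    half of it: divide by the product of the [z - q] over the zeros [q] and apply
    the maximum principle.  Squaring [f] makes the quotient vanish at the zeros,
    so that no discussion of removable singularities is needed. *)
Lemma many_zeros_small f w (rho M : R) s : 0 < rho ->
  (forall z, cdisc w rho z -> twice f z) ->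
  (forall z, cdisc w rho z -> normc (f z) <= M) -> uniq s ->
  (forall q, q \in s -> f q = 0 /\ normc (cx q - cx w) <= rho / 8) ->
  forall z, cdisc w (rho / 2) z ->
  normc (f z) ^+ 2 <= M ^+ 2 * (5 / 7) ^+ size s.
Proof.
move=> r0 tf fM us sP z zr2.
have Kw := cdisc_center w (ltW r0).
have M0 : 0 <= M := le_trans (normc_ge0 _) (fM _ Kw).
pose pi y := \prod_(q <- s) (cx y - cx q).
pose psi y := f y * (f y / pi y).
have c78 : 0 < 7 / 8 * rho by rewrite mulr_gt0 // divr_gt0.
have pisize (c d : R) y : 0 <= c -> (forall q, q \in s -> c <= normc (cx y - cx q) <= d) ->
    c ^+ size s <= normc (pi y) <= d ^+ size s.
  move=> cge0; rewrite /pi normc_prod; elim: (s) => [|q t IH] H.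
    by rewrite big_nil !expr0 lexx.
  have /andP[h1 h2] := H q (mem_head _ _).
  have /andP[h3 h4] : c ^+ size t <= \prod_(q <- t) normc (cx y - cx q) <= d ^+ size t.
    by apply: IH => v vt; apply: H; rewrite in_cons vt orbT.
  have p0 : 0 <= \prod_(q <- t) normc (cx y - cx q).
    by apply: le_trans h3; rewrite exprn_ge0.
  rewrite big_cons [size _]/= !exprS; apply/andP.
  by split; apply: ler_pM; rewrite ?exprn_ge0 ?normc_ge0.
have tpsi y : cdisc w rho y -> y \notin s -> twice psi y.
  move=> Ky ys; apply: twiceM; first exact: tf.
  by apply: twiceM; [exact: tf|apply: twiceV; [rewrite prod_neq0|exact: twice_prod]].
(* At a zero [y] the factor [z - y] of the denominator cancels against the
   difference quotient of one of the two copies of [f]; the other copy makes the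
   value 0. *)
have cpsi y : cdisc w rho y -> y \in s -> ccont psi y.
  move=> Ky ys; have [q [cq _ fE]] := twice_cD (tf _ Ky).
  have [f0 _] := sP y ys.
  pose rest v := \prod_(q <- rem y s) (cx v - cx q).
  have -> : psi = fun v => f v * (q v / rest v).
    apply/funext => v; rewrite /psi; have [->|vy] := eqVneq v y.
      by rewrite f0 !mul0r.
    congr (_ * _); rewrite {1}fE f0 add0r /pi (big_rem y) //= -/(rest v) invfM.
    by rewrite mulrA mulfK // cxB_eq0.
  apply: ccontM; first exact/twice_ccont/tf.
  apply: ccontM => //; apply: ccontV; last exact/twice_ccont/twice_prod.
  by rewrite prod_neq0 mem_rem_uniq // inE eqxx.
have r_ge0 := ltW r0.
have B0 : 0 <= M ^+ 2 / (7 / 8 * rho) ^+ size s.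
  by apply: divr_ge0; rewrite exprn_ge0 // ltW.
have psiM y : cdisc w rho y -> normc (psi y) <= M ^+ 2 / (7 / 8 * rho) ^+ size s.
  apply: max_modulus => // [|v Kv|v Kv]; first exact: compact_cdisc.
    by have [vs|vs] := boolP (v \in s); [exact: cpsi|exact/twice_ccont/tpsi].
  have [vs|vs] := boolP (v \in s).
    by left; rewrite /psi (sP v vs).1 mul0r normcr0.
  have [vr|rv] := ltP (normc (cx v - cx w)) rho.
    by right; split; [exact: nbhs_cdisc|exact: tpsi].
  left; rewrite /psi mulrA normc_div normcrM -expr2.
  have /andP[h _] : (7 / 8 * rho) ^+ size s <= normc (pi v) <= (2 * rho) ^+ size s.
    apply: pisize => [|q /sP[_ qw]]; first exact: ltW.
    have := le_normc_add (cx v - cx q) (cx q - cx w).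
    have -> : cx v - cx q + (cx q - cx w) = cx v - cx w by ring.
    have := le_normc_sub (cx v - cx w) (cx q - cx w).
    have -> : cx v - cx w - (cx q - cx w) = cx v - cx q by ring.
    move: Kv qw rv; rewrite cdiscE.
    move: (normc (cx v - cx q)) (normc (cx v - cx w)) (normc (cx q - cx w)).
    by move=> *; apply/andP; split; lra.
  apply: ler_pM; rewrite ?exprn_ge0 ?invr_ge0 ?normc_ge0 //.
    by rewrite lerXn2r ?nnegrE ?normc_ge0 ?fM.
  by rewrite lef_pV2 // posrE ?exprn_gt0 // (lt_le_trans _ h) // exprn_gt0.
have [zs|zs] := boolP (z \in s).
  rewrite (sP z zs).1 normcr0 expr0n mulr_ge0 ?exprn_ge0 //.
have /andP[_ h] : 0 ^+ size s <= normc (pi z) <= (5 / 8 * rho) ^+ size s.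
  apply: pisize => // q /sP[_ qw]; rewrite normc_ge0 /=.
  have := le_normc_sub (cx z - cx w) (cx q - cx w).
  have -> : cx z - cx w - (cx q - cx w) = cx z - cx q by ring.
  by move: zr2; rewrite cdiscE => *; lra.
have Kz : cdisc w rho z by move: zr2; rewrite !cdiscE => *; lra.
have piz0 : 0 < normc (pi z) by rewrite normc_gt0 prod_neq0.
have := psiM z Kz; rewrite /psi mulrA normc_div normcrM -expr2 ler_pdivrMr //.
move=> /le_trans; apply.
have -> : M ^+ 2 * (5 / 7) ^+ size s =
   M ^+ 2 / (7 / 8 * rho) ^+ size s * (5 / 8 * rho) ^+ size s.
  have -> : 5 / 7 = (5 / 8 * rho) / (7 / 8 * rho) by field; rewrite gt_eqF.
  by rewrite expr_div_n mulrA [RHS]mulrAC.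
by rewrite ler_wpM2l.
Qed.

(** Letting the number of zeros grow in the previous bound. *)
Lemma infinite_zeros f w (rho : R) : 0 < rho ->
  (forall z, cdisc w rho z -> twice f z) ->
  (forall n, exists s, [/\ size s = n, uniq s &
     forall q, q \in s -> f q = 0 /\ normc (cx q - cx w) <= rho / 8]) ->
  forall z, cdisc w (rho / 2) z -> f z = 0.
Proof.
move=> r0 tf zeros z Kz; apply/eqP; rewrite -normc_eq0; apply/negPn/negP => fz0.
have [M M0 fM] := bounded_on_cdisc (ltW r0) tf.
have y0 : 0 < normc (f z) ^+ 2 by rewrite exprn_even_gt0.
have : (1 : R) <= 5 / 7.
  apply: (@le_of_powers _ _ _ (M ^+ 2 / normc (f z) ^+ 2)) => //.
  move=> n; rewrite expr1n mul1r mulrAC ler_pdivlMr // mul1r.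
  have [s [<- us sP]] := zeros n.
  exact: (many_zeros_small r0 tf fM us sP).
by lra.
Qed.

Lemma vanishing_open_zeros f q (r : R) n : 0 < r ->
  (forall z, normc (cx z - cx q) < r -> f z = 0) -> forall d : R, 0 < d ->
  exists s, [/\ size s = n, uniq s & forall z, z \in s ->
     f z = 0 /\ normc (cx z - cx q) <= d].
Proof.
move=> r0 f0 d d0; pose e := Num.min (r / 2) d.
have e0 : 0 < e by rewrite lt_min d0 divr_gt0.
have er : e < r.
  by apply: (@le_lt_trans _ _ (r / 2)); rewrite ?ge_min ?lexx // ltr_pdivrMr // ltr_pMr // ltr1n.
have ed : e <= d by rewrite ge_min lexx orbT.
pose x (j : nat) : R := e / j.+1%:R.
have x0 j : 0 <= x j by rewrite divr_ge0 // ltW.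
have xe j : x j <= e by rewrite ler_pdivrMr ?ltr0n // ler_peMr ?ler1n // (ltW e0).
exists [seq translate q ((x j)%:C)%C | j <- iota 0 n]; split.
- by rewrite size_map size_iota.
- rewrite map_inj_uniq ?iota_uniq // => i j /(congr1 cx); rewrite !cx_translate.
  move=> /addrI /(congr1 (@complex.Re R)); rewrite !reR /x => /(mulfI (lt0r_neq0 e0)).
  by move=> /invr_inj/eqP; rewrite eqr_nat eqSS => /eqP.
- move=> z /mapP[j _ ->]; have E : normc (cx (translate q (x j)%:C%C) - cx q) = x j.
    by rewrite cx_translate addrAC subrr add0r normc_real ger0_norm.
  by split; [apply: f0|]; rewrite E; [exact: le_lt_trans er|exact: le_trans ed].
Qed.

(** A locally constant property holds everywhere on a connected set or nowhere. *)
Lemma connected_propagate D (A : P -> Prop) p0 : connected D ->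
  (forall p, D p -> \forall q \near p, D q -> (A p <-> A q)) ->
  D p0 -> A p0 -> forall p, D p -> A p.
Proof.
move=> cD loc Dp0 Ap0.
have open_nb (B : P -> Prop) : open [set q | exists2 p, D p /\ B p &
    nbhs q [set v | D v -> (A p <-> A v)]].
  rewrite openE => q [p Bp nq]; have := nbhs_interior nq.
  by apply: filterS => v nv; exists p.
suff E : D `&` [set p | A p] = D by move=> p; rewrite -E => -[].
apply: cD; first by exists p0.
- exists [set q | exists2 p, D p /\ A p & nbhs q [set v | D v -> (A p <-> A v)]].
    exact: open_nb.
  apply/seteqP; split => [p [Dp Ap]|q [Dq [p [Dp Ap] nq]]]; split => //.
    by exists p => //; exact: loc.
  by have := nbhs_singleton nq Dq => /= -[+ _]; apply.
- exists (~` [set q | exists2 p, D p /\ ~ A p & nbhs q [set v | D v -> (A p <-> A v)]]).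
    by apply: open_closedC; exact: (open_nb (fun p => ~ A p)).
  apply/seteqP; split => [p [Dp Ap]|q [Dq nA]]; split => //.
    by move=> [v [Dv nAv] nq]; have := nbhs_singleton nq Dp => /= -[_ h]; exact/nAv/h.
  by apply: contrapT => nAq; apply: nA; exists q => //; exact: loc.
Qed.

(** Vanishing near a point is a locally constant property: at two points that are
    close relative to the domain, each disc of zeros forces the other one. *)
Lemma identity_connected V D f p0 : open V -> hol V f -> D `<=` V ->
  connected D -> D p0 -> (\forall z \near p0, f z = 0) ->
  forall p, D p -> \forall z \near p, f z = 0.
Proof.
move=> oV hf DV cD Dp0 f0.
apply: (@connected_propagate D (fun p => \forall z \near p, f z = 0) p0) => //.
move=> p Dp; have /near_discP[r r0 tf] := hol_near oV hf (DV _ Dp).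
pose rho := r / 2; have rho0 : 0 < rho by rewrite divr_gt0.
have tK z : cdisc p rho z -> twice f z.
  by rewrite cdiscE => zr; apply: tf; rewrite /rho in zr; lra.
have key q : normc (cx q - cx p) < rho / 16 -> (\forall z \near q, f z = 0) ->
    forall z, cdisc p (rho / 2) z -> f z = 0.
  move=> qp /near_discP[e e0 fe]; apply: (infinite_zeros rho0 tK) => n.
  have d0 : 0 < rho / 16 by rewrite divr_gt0.
  have [s [sn us sP]] := vanishing_open_zeros n e0 fe d0.
  exists s; split => // z /sP[fz zq]; split => //.
  have -> : cx z - cx p = (cx z - cx q) + (cx q - cx p) by ring.
  by apply: le_trans (le_normc_add _ _) _; lra.
apply/near_discP; exists (rho / 16) => [|q qp _]; first by rewrite divr_gt0.
have near0 q' : normc (cx q' - cx p) < rho / 16 ->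
    (forall z, cdisc p (rho / 2) z -> f z = 0) -> \forall z \near q', f z = 0.
  move=> qp' fz; have : nbhs q' (cdisc p (rho / 2)) by apply: nbhs_cdisc; lra.
  by apply: filterS.
have pp : normc (cx p - cx p) < rho / 16 by rewrite subrr normcr0 divr_gt0.
by split=> [/(key p pp)/(near0 _ qp)|/(key q qp)/(near0 _ pp)].
Qed.

End IdentityTheorem.

(** * Goursat forms and biharmonic functions *)

Section Biharmonic.
Context {R : realType}.
Local Notation P := (R * R)%type.
Local Notation C := R[i].
Local Notation re := (@complex.Re R).
Local Notation im := (@complex.Im R).
Implicit Types (p w z v : P) (a b l : C) (k n : nat) (f g s : P -> C) (F G : P -> R)
  (U V : set P).

Lemma twice_reflect f s p : twice f (pt (conjc (s p))) -> twice s p ->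
  twice (fun w => conjc (f (pt (conjc (s w))))) p.
Proof.
move=> [f1 df [l dl]] ts; have cs := twice_ccont ts.
move: ts => [s1 ds [m dm]].
have df' : \forall w \near p, cderiv f (pt (conjc (s w))) (f1 (pt (conjc (s w)))).
  have h : pt (conjc (s w)) @[w --> p] --> pt (conjc (s p)).
    exact/continuous_pt/ccontJ.
  exact: (h _ df).
exists (fun w => conjc (f1 (pt (conjc (s w)))) * s1 w).
  by apply: (@filterS2 _ (nbhs p) _ _ _ _ _ df' ds) => w; exact: cderiv_reflect.
move: ds => /nbhs_singleton ds.
eexists; apply: cderivM; last exact: dm.
exact: cderiv_reflect dl ds.
Qed.

Lemma near_derive F G p v : (\forall z \near p, F z = G z) ->
  'D_v F p = 'D_v G p.
Proof. by move=> FG; apply: near_eq_derive. Qed.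

Lemma near_is_derive F G p v (d : R) : (\forall z \near p, F z = G z) ->
  is_derive p v F d -> is_derive p v G d.
Proof. by move=> FG; apply: near_eq_is_derive. Qed.

Lemma class_C_cont k U F : class_C k U F -> forall p, U p -> {for p, continuous F}.
Proof. by case: k => [|k] []. Qed.

Lemma near_continuous F G p : (\forall z \near p, F z = G z) ->
  {for p, continuous F} -> {for p, continuous G}.
Proof.
move=> FG cF.
have FGp : F p = G p := nbhs_singleton FG.
rewrite /prop_for /continuous_at -FGp.
by apply: cvg_trans cF; apply: near_eq_cvg; apply: filterS FG => z.
Qed.

Lemma eq_class_C k U F G : open U -> (forall p, U p -> F p = G p) ->
  class_C k U F -> class_C k U G.
Proof.
move=> oU; elim: k F G => [|k IH] F G FG [cF HF];
  have FGp p (Up : U p) : \forall z \near p, F z = G z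
    by apply: filterS (open_near oU Up) => z /FG.
  by split => // p Up; apply: near_continuous (cF p Up); exact: FGp.
move: HF => [dF Cx Cy]; split.
  by move=> p Up; apply: near_continuous (cF p Up); exact: FGp.
split.
- move=> p Up; have [d1 d2] := dF p Up.
  by split; [apply: near_eq_derivable d1|apply: near_eq_derivable d2]; exact: FGp.
- by apply: IH Cx => p /FGp h; exact: near_derive.
- by apply: IH Cy => p /FGp h; exact: near_derive.
Qed.

(** Smoothness can be established from any functions that compute the partial
    derivatives on the open set, rather than from the total derivatives. *)
Lemma class_C_step k U F Fx Fy : open U ->
  (forall p, U p -> {for p, continuous F}) ->
  (forall p, U p -> is_derive p ex F (Fx p)) ->
  (forall p, U p -> is_derive p ey F (Fy p)) ->
  class_C k U Fx -> class_C k U Fy -> class_C k.+1 U F.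
Proof.
move=> oU cF dx dy Cx Cy; split => //; split.
- by move=> p Up; split; [case: (dx p Up)|case: (dy p Up)].
- by apply: (eq_class_C oU) Cx => p Up; case: (dx p Up).
- by apply: (eq_class_C oU) Cy => p Up; case: (dy p Up).
Qed.

Lemma class_C_leS k U F : class_C k.+1 U F -> class_C k U F.
Proof.
elim: k F => [|k IH] F [cF [dF Cx Cy]]; first by split.
exact (conj cF (And3 dF (IH _ Cx) (IH _ Cy))).
Qed.

Lemma class_C_is_derive k U F p : class_C k.+1 U F -> U p ->
  is_derive p ex F ('D_ex F p) /\ is_derive p ey F ('D_ey F p).
Proof.
by move=> [_ [dF _ _]] Up; have [? ?] := dF p Up; split; exact: derivableP.
Qed.

Lemma class_C_partials k U F : class_C k.+1 U F ->
  class_C k U ('D_ex F) /\ class_C k U ('D_ey F).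
Proof. by move=> [_ [_ Cx Cy]]; exact (conj Cx Cy). Qed.

Lemma class_CD k U F G : open U -> class_C k U F -> class_C k U G ->
  class_C k U (fun p => F p + G p).
Proof.
move=> oU; elim: k F G => [|k IH] F G CF CG.
  by split=> [p Up|//]; apply: cvgD; [exact: (class_C_cont CF)|exact: (class_C_cont CG)].
have [Fx Fy] := class_C_partials CF; have [Gx Gy] := class_C_partials CG.
apply: (class_C_step oU _ _ _ (IH _ _ Fx Gx) (IH _ _ Fy Gy)) => p Up.
- by apply: cvgD; [exact: (class_C_cont CF)|exact: (class_C_cont CG)].
- apply: is_derive_sum; [exact: (class_C_is_derive CF Up).1|].
  exact: (class_C_is_derive CG Up).1.
- apply: is_derive_sum; [exact: (class_C_is_derive CF Up).2|].
  exact: (class_C_is_derive CG Up).2.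
Qed.

Lemma is_derive_opp F p v (d : R) : is_derive p v F d ->
  is_derive p v (fun z => - F z) (- d).
Proof. exact: is_deriveN. Qed.

Lemma class_CN k U F : open U -> class_C k U F -> class_C k U (fun p => - F p).
Proof.
move=> oU; elim: k F => [|k IH] F CF.
  by split=> [p Up|//]; apply: cvgN; exact: (class_C_cont CF).
have [Fx Fy] := class_C_partials CF.
apply: (class_C_step oU _ _ _ (IH _ Fx) (IH _ Fy)) => p Up.
- by apply: cvgN; exact: (class_C_cont CF).
- by apply: is_derive_opp; exact: (class_C_is_derive CF Up).1.
- by apply: is_derive_opp; exact: (class_C_is_derive CF Up).2.
Qed.

(** Goursat's general form of a biharmonic function. *)
Definition goursat f g p : R := re (conjc (cx p) * f p + g p).

Lemma cx_ex : cx ex = 1 :> C. Proof. by []. Qed.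
Lemma cx_ey : cx ey = 'i%C :> C. Proof. by []. Qed.

Lemma cderiv_is_derive_im f p l v :
  cderiv f p l -> is_derive p v (fun w => im (f w)) (im (l * cx v)).
Proof.
have imE (y : C) : im y = re ((0 -i* 1)%C * y).
  by rewrite reM /= mul0r sub0r mulN1r opprK.
move=> df; have := cderiv_is_derive v (cderivZ (0 -i* 1)%C df).
by under [X in is_derive _ _ X]eq_fun do rewrite -imE; rewrite -mulrA -imE.
Qed.

Lemma goursat_is_derive f g p v a b : cderiv f p a -> cderiv g p b ->
  is_derive p v (goursat f g)
    (re (conjc (cx p) * (cx v * a) + (conjc (cx v) * f p + cx v * b))).
Proof.
move=> df dg.
have dx := cderiv_is_derive v (cderiv_cx p).
have dy := cderiv_is_derive_im v (cderiv_cx p).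
have D := is_derive_sum (is_derive_sum
  (is_derive_prod dx (cderiv_is_derive v df))
  (is_derive_prod dy (cderiv_is_derive_im v df))) (cderiv_is_derive v dg).
have -> : goursat f g =
  fun w => re (cx w) * re (f w) + im (cx w) * im (f w) + re (g w).
  by apply/funext => w; rewrite /goursat reD reM reJ imJ mulNr opprK.
apply: (is_derive_eq D).
rewrite !(reD, reM, imM, reJ, imJ, re1, im1); ring.
Qed.

Lemma goursat_cont f g p : ccont f p -> ccont g p -> {for p, continuous (goursat f g)}.
Proof.
move=> cf cg.
have [] : ccont (fun w => conjc (cx w) * f w + g w) p.
  by apply: ccontD => //; apply: ccontM => //; apply/ccontJ/ccont_cx.
by [].
Qed.

Section Goursat.
Context (U : set P) (oU : open U).

(** The partial derivatives of a Goursat form are again Goursat forms, so a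
    single induction gives smoothness of every order. *)
Lemma goursat_class_C n f g : hol U f -> hol U g -> class_C n U (goursat f g).
Proof.
elim: n f g => [|n IH] f g hf hg.
  by split=> [p Up|//]; apply: goursat_cont; apply: twice_ccont; [exact: hf|exact: hg].
pose dir v := goursat (fun p => cx v * cD f p)
  (fun p => conjc (cx v) * f p + cx v * cD g p).
have Cdir v : class_C n U (dir v).
  have hc c : hol U (fun=> c) by move=> p _; exact: twice_cst.
  have [hf1 hg1] := (hol_cD oU hf, hol_cD oU hg).
  apply: IH => p Up; first by apply: twiceM; [exact: hc|exact: hf1].
  by apply: twiceD; apply: twiceM; [exact: hc|exact: hf|exact: hc|exact: hg1].
have dP p v : U p -> is_derive p v (goursat f g) (dir v p).
  by move=> Up; apply: goursat_is_derive; apply: twice_cD; [exact: hf|exact: hg].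
apply: (class_C_step oU _ _ _ (Cdir ex) (Cdir ey)) => p Up; try exact: dP.
by apply: goursat_cont; apply: twice_ccont; [exact: hf|exact: hg].
Qed.

Lemma laplacian_goursat f g p : hol U f -> hol U g -> U p ->
  laplacian (goursat f g) p = 4 * re (cD f p).
Proof.
move=> hf hg Up.
have [hf1 hg1] := (hol_cD oU hf, hol_cD oU hg).
pose dir v := goursat (fun p => cx v * cD f p)
  (fun p => conjc (cx v) * f p + cx v * cD g p).
have D1 v : \forall z \near p, 'D_v (goursat f g) z = dir v z.
  apply: filterS (open_near oU Up) => z Uz.
  have D : is_derive z v (goursat f g) (dir v z).
    by apply: goursat_is_derive; apply: twice_cD; [exact: hf|exact: hg].
  exact: derive_val.
have D2 v : 'D_v ('D_v (goursat f g)) p =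
   re (conjc (cx p) * (cx v * (cx v * cD (cD f) p)) +
       (conjc (cx v) * (cx v * cD f p) + cx v * (conjc (cx v) * cD f p + cx v * cD (cD g) p))).
  rewrite (near_derive v (D1 v)).
  have D : is_derive p v (dir v) (re (conjc (cx p) * (cx v * (cx v * cD (cD f) p)) +
       (conjc (cx v) * (cx v * cD f p) + cx v * (conjc (cx v) * cD f p + cx v * cD (cD g) p)))).
    apply: goursat_is_derive; first exact/cderivZ/twice_cD2/hf.
    by apply: cderivD; apply: cderivZ; [exact/twice_cD/hf|exact/twice_cD2/hg].
  exact: derive_val.
rewrite /laplacian !D2 cx_ex cx_ey -reD.
have -> : 4 * re (cD f p) = re (cD f p + cD f p + cD f p + cD f p) :> R.
  by rewrite !reD; ring.
congr (re _).
have ii : 'i%C * 'i%C = -1 :> C by rewrite -expr2 sqr_i.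
have ci : conjc 'i%C = - 'i%C :> C by apply: complex_eq; rewrite /= ?oppr0.
rewrite ci conjc1.
move: (conjc (cx p)) (cD f p) (cD (cD f) p) (cD (cD g) p) 'i%C ii => K A B D i ii.
transitivity (K * (B + i * i * B) + (A + A + D) + (i * i) * (D - A - A)).
  by ring.
by rewrite ii; ring.
Qed.

Lemma laplacian_near F G p : (\forall z \near p, F z = G z) ->
  laplacian F p = laplacian G p.
Proof.
move=> /near_near FG.
have E v : 'D_v ('D_v F) p = 'D_v ('D_v G) p.
  apply: near_derive; apply: (@filterS _ (nbhs p) _ _ _ _ FG) => z h.
  exact: near_derive h.
by rewrite /laplacian (E ex) (E ey).
Qed.

Lemma biharmonic_goursat f g : hol U f -> hol U g -> biharmonic U (goursat f g).
Proof.
move=> hf hg; split; first exact: goursat_class_C.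
move=> p Up.
have hc c : hol U (fun=> c) by move=> z _; exact: twice_cst.
have h4 : hol U (fun z => 4 * cD f z).
  by move=> z Uz; apply: twiceM; [exact: twice_cst|exact: (hol_cD oU hf)].
rewrite (@laplacian_near _ (goursat (fun=> 0) (fun z => 4 * cD f z))).
  by rewrite (laplacian_goursat (hc 0) h4 Up) (cD_cderiv (cderiv_cst 0 p)) mulr0.
apply: filterS (open_near oU Up) => z Uz; rewrite (laplacian_goursat hf hg Uz).
rewrite /goursat mulr0 add0r.
have -> : 4 * cD f z = cD f z + cD f z + cD f z + cD f z by ring.
by rewrite !reD; ring.
Qed.

End Goursat.
End Biharmonic.

(** * Partial derivatives and the Cauchy-Riemann equations *)

Section PartialDerivatives.
Context {R : realType}.
Local Notation P := (R * R)%type.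
Local Notation C := R[i].
Local Notation re := (@complex.Re R).
Local Notation im := (@complex.Im R).
Implicit Types (p w z c : P) (u v F : P -> R) (U V : set P).

(** Partial derivatives are ordinary derivatives along horizontal or vertical
    lines, which gives access to the one-variable theory. *)
Lemma is_derive_slice1 u p (d : R) :
  is_derive p ex u d <-> is_derive p.1 (1 : R) (fun t => u (t, p.2)) d.
Proof.
have E : (fun h : R => h^-1 *: (u (h *: ex + p) - u p)) =
  (fun h : R => h^-1 *: (u (h *: (1 : R) + p.1, p.2) - u (p.1, p.2))).
  apply/funext => h; case: p => x y /=.
  by congr (_ *: (u (_, _) - _)); rewrite /= scaler0 add0r.
by split=> -[d1 d2]; split; rewrite /derivable /derive /= ?E // -E.
Qed.

Lemma is_derive_slice2 u p (d : R) :
  is_derive p ey u d <-> is_derive p.2 (1 : R) (fun t => u (p.1, t)) d.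
Proof.
have E : (fun h : R => h^-1 *: (u (h *: ey + p) - u p)) =
  (fun h : R => h^-1 *: (u (p.1, h *: (1 : R) + p.2) - u (p.1, p.2))).
  apply/funext => h; case: p => x y /=.
  by congr (_ *: (u (_, _) - _)); rewrite /= scaler0 add0r.
by split=> -[d1 d2]; split; rewrite /derivable /derive /= ?E // -E.
Qed.

Definition between (a b x : R) := (a <= x <= b) || (b <= x <= a).

Lemma between_dist (a b x : R) : between a b x -> `|x - a| <= `|b - a|.
Proof.
case/orP => /andP[h1 h2].
  by rewrite !ger0_norm ?subr_ge0 ?lerD2r // (le_trans h1).
rewrite distrC (distrC b) !ger0_norm ?subr_ge0 ?lerD2l ?lerN2 //.
exact: le_trans h2.
Qed.

Lemma mean_value_real (phi dphi : R -> R) (a b A e : R) :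
  (forall x, between a b x -> is_derive x (1 : R) phi (dphi x)) ->
  (forall x, between a b x -> `|dphi x - A| <= e) ->
  `|phi b - phi a - A * (b - a)| <= e * `|b - a|.
Proof.
move=> D De.
have key x y : x < y -> (forall t, x <= t <= y -> between a b t) ->
    `|phi y - phi x - A * (y - x)| <= e * `|y - x|.
  move=> xy H.
  have cphi : {within `[x, y]%classic, continuous phi}.
    apply: derivable_within_continuous => t; rewrite in_itv /= => ht.
    by case: (D t (H t ht)).
  have [|t] := @MVT R phi dphi x y xy _ cphi.
    by move=> t; rewrite in_itv /= => /andP[h1 h2]; apply/D/H; rewrite !ltW.
  rewrite in_itv /= => /andP[h1 h2] ->.
  rewrite -mulrBl normrM ler_wpM2r // De // H // !ltW //.
have [ab|ba|->] := ltgtP a b; last by rewrite !subrr mulr0 subrr normr0 mulr0.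
  by apply: (key a b) => // t ht; rewrite /between ht.
have -> : phi b - phi a - A * (b - a) = - (phi a - phi b - A * (a - b)) by ring.
rewrite normrN (distrC b); apply: (key b a) => // t ht.
by rewrite /between ht orbT.
Qed.

(** Moving first vertically and then horizontally, continuous partial derivatives
    control the increment to first order. *)
Lemma increment_le u (u1 u2 : P -> R) p (r e : R) :
  (forall z, ball p r z -> is_derive z ex u (u1 z) /\ is_derive z ey u (u2 z)) ->
  (forall z, ball p r z -> `|u1 z - u1 p| <= e /\ `|u2 z - u2 p| <= e) ->
  forall w, ball p r w ->
  `|u w - u p - u1 p * (w.1 - p.1) - u2 p * (w.2 - p.2)| <=
  e * (`|w.1 - p.1| + `|w.2 - p.2|).
Proof.
move=> D De [x y] /ball_planeP /= [h1 h2].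
have r0 : 0 < r := le_lt_trans (normr_ge0 _) h1.
have B1 t : between p.1 x t -> ball p r (t, y).
  by move=> /between_dist ht; apply/ball_planeP; rewrite /= distrC (le_lt_trans ht) // distrC.
have B2 t : between p.2 y t -> ball p r (p.1, t).
  move=> /between_dist ht; apply/ball_planeP; rewrite /= subrr normr0 r0.
  by rewrite distrC (le_lt_trans ht) // distrC.
have k1 := @mean_value_real (fun t => u (t, y)) (fun t => u1 (t, y)) p.1 x (u1 p) e
  (fun t ht => (is_derive_slice1 u (t, y) (u1 (t, y))).1 (D _ (B1 t ht)).1)
  (fun t ht => (De _ (B1 t ht)).1).
have k2 := @mean_value_real (fun t => u (p.1, t)) (fun t => u2 (p.1, t)) p.2 y (u2 p) e
  (fun t ht => (is_derive_slice2 u (p.1, t) (u2 (p.1, t))).1 (D _ (B2 t ht)).2)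
  (fun t ht => (De _ (B2 t ht)).2).
have -> : u (x, y) - u p - u1 p * (x - p.1) - u2 p * (y - p.2) =
  (u (x, y) - u (p.1, y) - u1 p * (x - p.1)) +
  (u (p.1, y) - u (p.1, p.2) - u2 p * (y - p.2)).
  by case: (p) => ? ? /=; ring.
by apply: le_trans (ler_normD _ _) _; rewrite [leRHS]mulrDr lerD.
Qed.

(** Continuous partial derivatives subject to the Cauchy-Riemann equations
    assemble into a complex derivative. *)
Lemma cauchy_riemann u v (a b : P -> R) p :
  (\forall z \near p, is_derive z ex u (a z) /\ is_derive z ey u (- b z)) ->
  (\forall z \near p, is_derive z ex v (b z) /\ is_derive z ey v (a z)) ->
  {for p, continuous a} -> {for p, continuous b} ->
  cderiv (fun z => (u z +i* v z)%C) p (a p +i* b p)%C.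
Proof.
move=> du dv ca cb; apply/cderivP => e e0.
have e4 : 0 < e / 4 by rewrite divr_gt0.
move/cvgrPdist_lt : ca => /(_ _ e4) ca; move/cvgrPdist_lt : cb => /(_ _ e4) cb.
have : \forall z \near p,
  ((is_derive z ex u (a z) /\ is_derive z ey u (- b z)) /\
   (is_derive z ex v (b z) /\ is_derive z ey v (a z))) /\
  (`|a p - a z| < e / 4 /\ `|b p - b z| < e / 4).
  by apply: filterI; apply: filterI.
move=> /nbhs_ballP[r /= r0 H]; apply/nbhs_ballP; exists r => //= w pw.
have ea z : ball p r z -> `|a z - a p| <= e / 4.
  by move=> /H[_ [h _]]; rewrite distrC ltW.
have eb z : ball p r z -> `|b z - b p| <= e / 4.
  by move=> /H[_ [_ h]]; rewrite distrC ltW.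
have nb z : ball p r z -> `|- b z - - b p| <= e / 4.
  by move=> hz; rewrite -opprD normrN; exact: eb.
have ku := @increment_le u a (fun z => - b z) p r (e / 4) (fun z hz => (H z hz).1.1)
  (fun z hz => conj (ea z hz) (nb z hz)) w pw.
have kv := @increment_le v b a p r (e / 4) (fun z hz => (H z hz).1.2)
  (fun z hz => conj (eb z hz) (ea z hz)) w pw.
apply: le_trans (normc_le_add _) _.
have N1 : `|w.1 - p.1| <= normc (cx w - cx p) by rewrite -cxB_re re_le_normc.
have N2 : `|w.2 - p.2| <= normc (cx w - cx p) by rewrite -cxB_im im_le_normc.
have -> : re ((u w +i* v w)%C - (u p +i* v p)%C - (a p +i* b p)%C * (cx w - cx p)) =
   u w - u p - a p * (w.1 - p.1) - - b p * (w.2 - p.2).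
  by rewrite !(reD, reN, reM, cxB_re, cxB_im) /=; ring.
have -> : im ((u w +i* v w)%C - (u p +i* v p)%C - (a p +i* b p)%C * (cx w - cx p)) =
   v w - v p - b p * (w.1 - p.1) - a p * (w.2 - p.2).
  by rewrite !(imD, imN, imM, cxB_re, cxB_im) /=; ring.
have : e / 4 * (`|w.1 - p.1| + `|w.2 - p.2|) <= e / 4 * (2 * normc (cx w - cx p)).
  by rewrite ler_pM2l //; lra.
by move: ku kv; lra.
Qed.

End PartialDerivatives.

(** * Closed forms on a square *)

Section LocalPotential.
Context {R : realType}.
Local Notation P := (R * R)%type.
Local Notation mu := (@lebesgue_measure R).
Implicit Types (p w z c : P) (u v F : P -> R) (U V : set P).

Lemma cont_slice1 u (x y : R) : {for (x, y), continuous u} ->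
  {for x, continuous (fun t => u (t, y))}.
Proof.
move=> cu; apply: (@cvg_comp _ _ _ (fun t => (t, y)) u _ (nbhs (x, y))) => //.
exact: (cvg_pair (@cvg_id _ (nbhs x)) (@cvg_cst _ y _ _ _)).
Qed.

Lemma cont_slice2 u (x y : R) : {for (x, y), continuous u} ->
  {for y, continuous (fun t => u (x, t))}.
Proof.
move=> cu; apply: (@cvg_comp _ _ _ (fun t => (x, t)) u _ (nbhs (x, y))) => //.
exact: (cvg_pair (@cvg_cst _ x _ _ _) (@cvg_id _ (nbhs y))).
Qed.

Lemma integrable_slice (f : R -> R) (a b : R) :
  (forall t, a <= t <= b -> {for t, continuous f}) ->
  mu.-integrable `[a, b] (EFin \o f).
Proof.
move=> cf; apply: continuous_compact_integrable; first exact: segment_compact.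
apply: continuous_in_subspaceT => t; rewrite inE /= in_itv /= => ht.
exact: cf.
Qed.

Lemma is_derive_derive1 (f : R -> R) x (d : R) :
  derivable f x 1 /\ derive1 f x = d -> is_derive x (1 : R) f d.
Proof. by move=> [df fd]; split => //; rewrite -derive1E. Qed.

Lemma integral_of_derivative (f df : R -> R) (a b : R) : a < b ->
  (forall t, a <= t <= b -> is_derive t (1 : R) f (df t)) ->
  (forall t, a <= t <= b -> {for t, continuous df}) ->
  (\int[mu]_(t in `[a, b]) df t)%R = f b - f a.
Proof.
move=> ab dfP cdf; rewrite /Rintegral (@continuous_FTC2 _ df f) //.
- by apply: continuous_in_subspaceT => t; rewrite inE /= in_itv /= => /cdf.
- have cf : {within `[a, b]%classic, continuous f}.
    apply: derivable_within_continuous => t; rewrite in_itv /= => ht.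
    by case: (dfP t ht).
  have [_ h2 h3] := (continuous_within_itvP f ab).1 cf.
  split => // t; rewrite in_itv /= => /andP[h4 h5].
  by case: (dfP t _) => //; rewrite !ltW.
- move=> t; rewrite in_itv /= => /andP[h4 h5]; rewrite derive1E.
  by case: (dfP t _) => //; rewrite !ltW.
Qed.

(** Integrating along an L-shaped path from a corner gives a potential on a
    square; the derivative across the second leg is computed under the integral
    sign and turned into boundary terms by closedness. *)
Lemma local_potential (A B d : P -> R) c (r : R) : 0 < r ->
  (forall z, ball c r z -> [/\ {for z, continuous A}, {for z, continuous B} &
     {for z, continuous d}]) ->
  (forall z, ball c r z -> is_derive z ey A (d z) /\ is_derive z ex B (d z)) ->
  exists phi : P -> R, forall z, ball c (r / 2) z ->
    is_derive z ex phi (A z) /\ is_derive z ey phi (B z).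
Proof.
move=> r0 cont der.
pose a1 := c.1 - r / 2; pose b1 := c.1 + r / 2.
pose a2 := c.2 - r / 2; pose b2 := c.2 + r / 2.
have sq x y : a1 <= x <= b1 -> a2 <= y <= b2 -> ball c r (x, y).
  move=> /andP[h1 h2] /andP[h3 h4]; apply/ball_planeP => /=.
  by rewrite !ltr_norml /a1 /b1 /a2 /b2 in h1 h2 h3 h4 *; split; apply/andP; split; lra.
have [a1b1 a2b2] : a1 < b1 /\ a2 < b2 by rewrite /a1 /b1 /a2 /b2; split; lra.
have cS x y : a1 <= x <= b1 -> a2 <= y <= b2 -> [/\ {for (x, y), continuous A},
    {for (x, y), continuous B} & {for (x, y), continuous d}].
  by move=> hx hy; exact/cont/sq.
have dS x y : a1 <= x <= b1 -> a2 <= y <= b2 ->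
    is_derive y (1 : R) (fun t => A (x, t)) (d (x, y)) /\
    is_derive x (1 : R) (fun t => B (t, y)) (d (x, y)).
  move=> hx hy; have [h1 h2] := der _ (sq x y hx hy).
  by split; [exact/(is_derive_slice2 A (x, y))|exact/(is_derive_slice1 B (x, y))].
have a1i : a1 <= a1 <= b1 by rewrite lexx ltW.
have a2i : a2 <= a2 <= b2 by rewrite lexx ltW.
pose phi p := (\int[mu]_(t in `[a1, p.1]) A (t, a2))%R +
  (\int[mu]_(s in `[a2, p.2]) B (p.1, s))%R.
exists phi => -[x y] /ball_planeP /= [].
rewrite !ltr_distl => /andP[x1 x2] /andP[y1 y2].
have xi : a1 < x < b1 by rewrite /a1 /b1; apply/andP; split; lra.
have yi : a2 < y < b2 by rewrite /a2 /b2; apply/andP; split; lra.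
have [ax xb] := andP xi; have [ay yb] := andP yi.
have xw : a1 <= x <= b1 by rewrite !ltW.
have yw : a2 <= y <= b2 by rewrite !ltW.
split.
- apply/is_derive_slice1 => /=.
  have D1 : is_derive x (1 : R) (fun t => \int[mu]_(s in `[a1, t]) A (s, a2))%R (A (x, a2)).
    apply: is_derive_derive1; apply: (@continuous_FTC1_closed _ _ _ _ b1) => //.
      by apply: integrable_slice => t ht; apply: cont_slice1; have [] := cS t a2 ht a2i.
    by apply: cont_slice1; have [] := cS x a2 xw a2i.
  have ys s : a2 <= s <= y -> a2 <= s <= b2.
    by move=> /andP[-> h] /=; exact: le_trans h (ltW yb).
  have Dint : (\int[mu]_(s in `[a2, y]) d (x, s))%R = A (x, y) - A (x, a2).
    apply: (@integral_of_derivative (fun s => A (x, s)) (fun s => d (x, s))) => // s /ys hs.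
      by have [] := dS x s xw hs.
    by apply: cont_slice2; have [] := cS x s xw hs.
  have [M HM] : exists M : R, forall s t, a1 <= s <= b1 -> a2 <= t <= b2 -> `|d (s, t)| <= M.
    have K : compact (`[a1, b1]%classic `*` `[a2, b2]%classic).
      by apply: compact_setX; exact: segment_compact.
    have [||m _ mM] := @compact_EVT_max _ R (fun z => `|d z|) _ _ K.
    - by exists (a1, a2); split; rewrite /= in_itv.
    - apply: continuous_in_subspaceT => -[s t]; rewrite inE => -[/=].
      rewrite !in_itv /= => hs ht; apply: cvg_norm.
      by have [] := cS s t hs ht.
    exists `|d m| => s t hs ht; apply: mM.
    by rewrite inE; split; rewrite /= in_itv.
  have D2 : is_derive x (1 : R) (fun t => \int[mu]_(s in `[a2, y]) B (t, s))%R
      (A (x, y) - A (x, a2)).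
    have mI : measurable (`[a2, y]%classic : set R) by exact: measurable_itv.
    have Ix : `]a1, b1[%classic x by rewrite /= in_itv.
    have Iw t : `]a1, b1[%classic t -> a1 <= t <= b1.
      by rewrite /= in_itv /= => /andP[h1 h2]; rewrite !ltW.
    have intB t : `]a1, b1[%classic t -> mu.-integrable `[a2, y] (EFin \o (fun s => B (t, s))).
      move=> /Iw ht; apply: integrable_slice => s /ys hs; apply: cont_slice2.
      by have [] := cS t s ht hs.
    have derB t s : `]a1, b1[%classic t -> `[a2, y]%classic s ->
        is_derive t (1 : R) (fun t => B (t, s)) (d (t, s)).
      by move=> /Iw ht; rewrite /= in_itv /= => /ys hs; have [] := dS t s ht hs.
    have pE t s : `]a1, b1[%classic t -> `[a2, y]%classic s ->
        partial1of2 (fun t s => B (t, s)) t s = d (t, s).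
      by move=> ht hs; rewrite partial1of2E; case: (derB t s ht hs).
    have M0 : 0 <= M := le_trans (normr_ge0 _) (HM _ _ a1i a2i).
    have intM : mu.-integrable `[a2, y] (EFin \o (fun=> M)).
      by apply: integrable_slice => t _; exact: cvg_cst.
    have derB' t s : `]a1, b1[%classic t -> `[a2, y]%classic s ->
        derivable (fun t => B (t, s)) t 1 by move=> ht hs; case: (derB t s ht hs).
    have bnd t s : `]a1, b1[%classic t -> `[a2, y]%classic s ->
        `|partial1of2 (fun t s => B (t, s)) t s| <= M.
      move=> ht hs; rewrite pE //; apply: HM; first exact: Iw.
      by move: hs; rewrite /= in_itv /= => /ys.
    apply: is_derive_derive1; split.
      exact: (@derivable_under_integral _ _ _ mu (fun t s => B (t, s)) _ mI x a1 b1
        Ix intB derB' (fun=> M) (fun=> M0) intM bnd).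
    rewrite (@differentiation_under_integral _ _ _ mu (fun t s => B (t, s)) _ mI x a1 b1
        Ix intB derB' (fun=> M) (fun=> M0) intM bnd) -Dint.
    by apply: eq_Rintegral => s; rewrite inE => hs; exact: pE.
  have -> : A (x, y) = A (x, a2) + (A (x, y) - A (x, a2)) by rewrite addrC subrK.
  exact: is_derive_sum D1 D2.
- apply/is_derive_slice2 => /=.
  have D3 : is_derive y (1 : R) (fun t => \int[mu]_(s in `[a2, t]) B (x, s))%R (B (x, y)).
    apply: is_derive_derive1; apply: (@continuous_FTC1_closed _ _ _ _ b2) => //.
      by apply: integrable_slice => t ht; apply: cont_slice2; have [] := cS x t xw ht.
    by apply: cont_slice2; have [] := cS x y xw yw.
  rewrite -[B (x, y)]add0r.
  pose k : R := (\int[mu]_(t in `[a1, x]) A (t, a2))%R.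
  have D4 := is_derive_sum (is_derive_cst k y (1 : R)) D3.
  exact: D4.
Qed.

End LocalPotential.

(** * Closed forms on a simply connected region *)

Section Monodromy.
Context {R : realType} (A B : R * R -> R) (U : set (R * R)).
Local Notation P := (R * R)%type.
Implicit Types (p q x y z c : P) (phi psi : P -> R) (D : set P) (g : R -> P).

Definition potential D phi := forall z, D z ->
  is_derive z ex phi (A z) /\ is_derive z ey phi (B z).

Lemma between_ball (a b t c r : R) : `|c - a| < r -> `|c - b| < r ->
  between a b t -> `|c - t| < r.
Proof.
rewrite !ltr_distl /between => /andP[? ?] /andP[? ?] h.
by apply/andP; case/orP: h => /andP[? ?]; split; lra.
Qed.

Lemma zero_derivative_between (f : R -> R) (a b : R) :
  (forall t, between a b t -> is_derive t (1 : R) f 0) -> f b = f a.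
Proof.
move=> df; have h t (_ : between a b t) : `|(0 : R) - 0| <= 0.
  by rewrite subrr normr0.
have := @mean_value_real R f (fun=> 0) a b 0 0 df h.
by rewrite !mul0r subr0 normr_le0 subr_eq0 => /eqP.
Qed.

(** Two squares meet in a rectangle, where the difference of the potentials is
    constant along horizontal and vertical segments. *)
Lemma potential_unique c r phi c' r' psi p q :
  potential (ball c r) phi -> potential (ball c' r') psi ->
  ball c r p -> ball c r q -> ball c' r' p -> ball c' r' q ->
  phi q - phi p = psi q - psi p.
Proof.
move=> hphi hpsi.
move=> /ball_planeP[p1 p2] /ball_planeP[q1 q2] /ball_planeP[p1' p2'] /ball_planeP[q1' q2'].
pose chi z := phi z - psi z.
have D z : ball c r z -> ball c' r' z -> is_derive z ex chi 0 /\ is_derive z ey chi 0.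
  move=> /hphi[h1 h2] /hpsi[h3 h4].
  by split; [rewrite -(subrr (A z))|rewrite -(subrr (B z))]; exact: is_derive_diff.
have e1 : chi (q.1, p.2) = chi (p.1, p.2).
  apply: (@zero_derivative_between (fun t => chi (t, p.2))) => t ht.
  apply: (is_derive_slice1 chi (t, p.2) 0).1.
  by apply: (D (t, p.2) _ _).1; apply/ball_planeP; split => //=;
    apply: (between_ball _ _ ht).
have e2 : chi (q.1, q.2) = chi (q.1, p.2).
  apply: (@zero_derivative_between (fun t => chi (q.1, t))) => t ht.
  apply: (is_derive_slice2 chi (q.1, t) 0).1.
  by apply: (D (q.1, t) _ _).2; apply/ball_planeP; split => //=;
    apply: (between_ball _ _ ht).
have : chi q = chi p by rewrite [q]surjective_pairing e2 e1 -surjective_pairing.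
by rewrite /chi; lra.
Qed.

(** By uniqueness the increment is a function of the two points; it is 0 by default
    when no square with a potential contains both. *)
Definition increments p q : set R := [set d | exists c r phi,
  [/\ potential (ball c r) phi, ball c r p, ball c r q & d = phi q - phi p]].
Definition incr p q : R := xget 0 (increments p q).

Lemma incrE c r phi p q : potential (ball c r) phi -> ball c r p -> ball c r q ->
  incr p q = phi q - phi p.
Proof.
move=> hphi bp bq; rewrite /incr.
case: xgetP => [d _ [c' [r' [psi [hpsi bp' bq' ->]]]]|/(_ (phi q - phi p))].
  exact: (potential_unique hpsi hphi).
by case; exists c, r, phi.
Qed.

Lemma incr_sym p q : incr q p = - incr p q.
Proof.
have [[d [c [r [phi [h bp bq _]]]]]|none] := pselect (increments p q !=set0).
  by rewrite (incrE h bp bq) (incrE h bq bp) opprB.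
have none' : ~ (increments q p !=set0).
  move=> [d [c [r [phi [h bp bq _]]]]]; apply: none.
  by exists (phi q - phi p), c, r, phi.
rewrite /incr; case: xgetP => [d _ hd|_]; first by case: none'; exists d.
by case: xgetP => [d _ hd|_]; [case: none; exists d|rewrite oppr0].
Qed.

Lemma incr_refl p : incr p p = 0.
Proof. by have := incr_sym p p; lra. Qed.

(** The integral of the closed form along [g], once the subdivision is fine
    enough. *)
Definition polygonal_sum n g : R :=
  \sum_(0 <= j < n) incr (g (j%:R / n%:R)) (g (j.+1%:R / n%:R)).

Local Notation I01 := (`[0 : R, 1]%classic).

Lemma grid_point (n j : nat) : (0 < n)%N -> (j <= n)%N -> I01 (j%:R / n%:R).
Proof.
move=> n0 jn; rewrite /= in_itv /= divr_ge0 ?ler0n //=.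
by rewrite ler_pdivrMr ?ltr0n // mul1r ler_nat.
Qed.

Context (oU : open U)
  (local_pot : forall c r, 0 < r -> ball c r `<=` U ->
     exists phi, potential (ball c (r / 2)) phi).

Lemma potential_near p : U p ->
  exists r phi, [/\ 0 < r, ball p r `<=` U & potential (ball p r) phi].
Proof.
move=> Up; have /nbhs_ballP[r /= r0 rU] := open_near oU Up.
have [phi h] := local_pot r0 rU; exists (r / 2), phi.
split => //; first by rewrite divr_gt0.
by apply: subset_trans rU; apply: le_ball; lra.
Qed.

Lemma ball_segment c r p q (t : R) : 0 <= t <= 1 -> ball c r p -> ball c r q ->
  ball c r (p + t *: (q - p)).
Proof.
move=> /andP[t0 t1] /ball_planeP[p1 p2] /ball_planeP[q1 q2].
have bt (a b x : R) : `|x - a| < r -> `|x - b| < r -> `|x - (a + t * (b - a))| < r.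
  move=> h1 h2; apply: (between_ball h1 h2); rewrite /between.
  have [ab|ba] := leP a b.
    apply/orP; left; have : 0 <= t * (b - a) <= b - a.
      by rewrite mulr_ge0 ?subr_ge0 //= ler_piMl ?subr_ge0.
    by move=> /andP[h3 h4]; apply/andP; split; lra.
  apply/orP; right; have : 0 <= t * (a - b) <= a - b.
    by rewrite mulr_ge0 ?subr_ge0 ?(ltW ba) //= ler_piMl ?subr_ge0 ?(ltW ba).
  have -> : t * (b - a) = - (t * (a - b)) by ring.
  by move=> /andP[h3 h4]; apply/andP; split; lra.
by apply/ball_planeP; split; exact: bt.
Qed.

(** A Lebesgue number for a homotopy: nearby points of the parameter square are
    mapped into a common square that carries a potential. *)
Lemma lebesgue_number (H : P -> P) : {within I01 `*` I01, continuous H} ->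
  (forall z, (I01 `*` I01) z -> U (H z)) ->
  exists2 e : R, 0 < e & forall x, (I01 `*` I01) x ->
    exists c r phi, potential (ball c r) phi /\
      forall y, (I01 `*` I01) y -> ball x e y -> ball c r (H y).
Proof.
move=> /subspace_continuousP cH HU.
have K : compact (I01 `*` I01) by apply: compact_setX; exact: segment_compact.
have /compact_near_coveringP nc := K.
pose good (e : R) x := exists c r phi, potential (ball c r) phi /\
      forall y, (I01 `*` I01) y -> ball x e y -> ball c r (H y).
have Pr : Filter (0 : R)^'+ by exact: at_right_proper_filter.
have := nc R (0 : R)^'+ good Pr.
case=> [x Ix|e /= e0 He].
  have [r [phi [r0 _ hphi]]] := potential_near (HU _ Ix).
  have : nbhs (H x) (ball (H x) r) by exact: nbhsx_ballx.
  move=> /(cH x Ix) /nbhs_ballP[d /= d0 Hd].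
  exists (ball x (d / 2), [set e | 0 < e < d / 2]) => /=.
    split; first by apply: nbhsx_ballx; rewrite divr_gt0.
    near=> e; apply/andP; split; near: e; first exact: nbhs_right_gt.
    by apply: nbhs_right_lt; rewrite divr_gt0.
  move=> [y e] /= [xy /andP[e0 ed]]; exists (H x), r, phi; split => // z Iz yz.
  apply: Hd => //; apply: (@le_ball _ _ _ (d / 2 + e)); first by lra.
  exact: ball_triangle xy yz.
exists (e / 2); first by rewrite divr_gt0.
apply: He; last by rewrite divr_gt0.
rewrite /ball_ /= sub0r normrN gtr0_norm ?divr_gt0 //.
by rewrite ltr_pdivrMr // ltr_pMr // ltr1n.
Unshelve. all: by end_near. Qed.

(** The sums over the successive stages of a homotopy agree, because around every
    cell of a fine grid the increments add up to zero. *)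
Lemma null_homotopic_sum g : null_homotopic U g ->
  exists N, forall n, (N <= n)%N -> polygonal_sum n g = 0.
Proof.
move=> [H [cH HU H0 H1 Hb]].
have [e e0 He] := lebesgue_number cH HU.
exists (Num.trunc e^-1).+1 => n Nn.
have n0 : (0 < n)%N by exact: leq_trans Nn.
have nR : 0 < n%:R :> R by rewrite ltr0n.
have ne : n%:R^-1 < e.
  rewrite -[e]invrK ltf_pV2 ?posrE ?invr_gt0 //.
  by apply: lt_le_trans (truncnS_gt _) _; rewrite ler_nat.
pose X i j := H (i%:R / n%:R, j%:R / n%:R).
pose T i := \sum_(0 <= j < n) incr (X i j) (X i j.+1).
(* The rows [i] and [i + 1] of the grid differ by increments along vertical sides
   that telescope to the two ends, where the homotopy is constant. *)
have step i : (i < n)%N -> T i = T i.+1.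
  move=> iN; apply/eqP; rewrite -subr_eq0 -sumrB.
  have Iin j : (j <= n)%N -> I01 (j%:R / n%:R : R) by exact: grid_point.
  rewrite (telescope_sumr_eq (fun j => - incr (X i j) (X i.+1 j))) //; last first.
    move=> j /andP[_ jn].
    have Ix : (I01 `*` I01) (i%:R / n%:R, j%:R / n%:R).
      by split; apply: Iin; exact: ltnW.
    have [c [r [phi [hphi Hc]]]] := He _ Ix.
    have bX k l : (k = i \/ k = i.+1) -> (l = j \/ l = j.+1) -> ball c r (X k l).
      have S a b : (b = a \/ b = a.+1) -> `|a%:R / n%:R - b%:R / n%:R : R| < e.
        case=> ->; first by rewrite subrr normr0.
        rewrite -mulrBl -natr1 opprD addrA subrr add0r mulN1r normrN.
        by rewrite ger0_norm // invr_ge0 ltW.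
      move=> hk hl; apply: Hc; last by apply/ball_planeP; split; exact: S.
      by split; apply: Iin; [case: hk => ->|case: hl => ->] => //; exact: ltnW.
    have b00 := bX i j (or_introl erefl) (or_introl erefl).
    have b01 := bX i j.+1 (or_introl erefl) (or_intror erefl).
    have b10 := bX i.+1 j (or_intror erefl) (or_introl erefl).
    have b11 := bX i.+1 j.+1 (or_intror erefl) (or_intror erefl).
    rewrite (incrE hphi b00 b01) (incrE hphi b10 b11) (incrE hphi b01 b11).
    by rewrite (incrE hphi b00 b10); ring.
  have side k : (k <= n)%N -> X k 0%N = g 0 /\ X k n = g 0.
    move=> kn; rewrite /X mul0r divff ?gt_eqF //; exact/Hb/Iin.
  have [s1 s2] := side i (ltnW iN); have [s3 s4] := side i.+1 iN.
  by rewrite s1 s2 s3 s4 !incr_refl subrr.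
have TT i : (i <= n)%N -> T 0%N = T i.
  elim: i => // i IH iN; rewrite -step //; exact/IH/ltnW.
have -> : polygonal_sum n g = T 0%N.
  apply: eq_big_nat => j /andP[_ jn].
  by rewrite /X mul0r !H0 //; apply: grid_point => //; exact: ltnW.
rewrite (TT n) // /T big_nat big1 // => j /andP[_ jn].
by rewrite /X divff ?gt_eqF // !H1 ?incr_refl //; apply: grid_point => //; exact: ltnW.
Qed.

(** Extends a curve parametrised by the unit interval to the whole line. *)
Definition clip (t : R) : R := Num.max 0 (Num.min 1 t).

Lemma clip_in t : I01 (clip t).
Proof.
by rewrite /= in_itv /= /clip le_max lexx /= ge_max ler01 ge_min lexx.
Qed.
Lemma clip_id t : I01 t -> clip t = t.
Proof.
by rewrite /= in_itv /= => /andP[t0 t1]; rewrite /clip min_r // max_r.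
Qed.
Lemma clip_le0 t : t <= 0 -> clip t = 0.
Proof. by move=> t0; rewrite /clip max_l // ge_min t0 orbT. Qed.
Lemma clip_ge1 t : 1 <= t -> clip t = 1.
Proof. by move=> t1; rewrite /clip min_l // max_r. Qed.

Lemma cvg_clip t : clip s @[s --> t] --> clip t.
Proof.
have c1 (c : R) : {for t, continuous (fun _ : R => c)} by exact: cvg_cst.
have ci : {for t, continuous (fun s : R => s)} by exact: cvg_id.
exact: (continuous_max (c1 0) (continuous_min (c1 1) ci)).
Qed.

Lemma curve_clip g (f : R -> R) (t : R) : curve_in U g -> f s @[s --> t] --> f t ->
  g (clip (f s)) @[s --> t] --> g (clip (f t)).
Proof.
move=> [/subspace_continuousP cg _] cf.
apply: (@cvg_comp _ _ _ (fun s => clip (f s)) g _ (within I01 (nbhs (clip (f t))))).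
  move=> S nS.
  have h : clip (f s) @[s --> t] --> clip (f t) := cvg_comp _ _ cf (@cvg_clip (f t)).
  have {nS}nS : \forall s \near t, I01 (clip (f s)) -> S (clip (f s)) := h _ nS.
  by apply: filterS nS => s; apply; exact: clip_in.
by apply: cg; exact: clip_in.
Qed.

(** The loop that runs along [g1] to [p], straight to [q], and back along [g2].
    Clipping the three parameters turns the concatenation into a sum, whose
    continuity needs no gluing. *)
Definition triangle_loop (g1 g2 : R -> P) p q (t : R) : P :=
  g1 (clip (3 * t)) + clip (3 * t - 1) *: (q - p) + (g2 (clip (3 - 3 * t)) - q).

Section Triangle.
Context (g1 g2 : R -> P) (p q : P) (n : nat).
Context (g1p : g1 1 = p) (g2q : g2 1 = q) (n0 : (0 < n)%N).
Let g := triangle_loop g1 g2 p q.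

Lemma triangle1 t : 0 <= t <= 1 -> g (t / 3) = g1 t.
Proof.
move=> /andP[t0 t1]; rewrite /g /triangle_loop.
have -> : 3 * (t / 3) = t by field.
have -> : clip t = t by apply: clip_id; rewrite /= in_itv /= t0.
have -> : clip (t - 1) = 0 by apply: clip_le0; lra.
have -> : clip (3 - t) = 1 by apply: clip_ge1; lra.
by rewrite scale0r addr0 g2q subrr addr0.
Qed.

Lemma triangle2 t : 0 <= t <= 1 -> g ((1 + t) / 3) = p + t *: (q - p).
Proof.
move=> /andP[t0 t1]; rewrite /g /triangle_loop.
have -> : 3 * ((1 + t) / 3) = 1 + t by field.
have -> : clip (1 + t) = 1 by apply: clip_ge1; lra.
have -> : clip (3 - (1 + t)) = 1 by apply: clip_ge1; lra.
have -> : 1 + t - 1 = t by ring.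
have -> : clip t = t by apply: clip_id; rewrite /= in_itv /= t0.
by rewrite g1p g2q subrr addr0.
Qed.

Lemma triangle3 t : 0 <= t <= 1 -> g ((2 + t) / 3) = g2 (1 - t).
Proof.
move=> /andP[t0 t1]; rewrite /g /triangle_loop.
have -> : 3 * ((2 + t) / 3) = 2 + t by field.
have -> : clip (2 + t) = 1 by apply: clip_ge1; lra.
have -> : clip (2 + t - 1) = 1 by apply: clip_ge1; lra.
rewrite g1p scale1r (addrC p) subrK.
have -> : 3 - (2 + t) = 1 - t by ring.
rewrite clip_id; last by rewrite /= in_itv /=; apply/andP; split; lra.
by rewrite addrC subrK.
Qed.

(** Subdividing the loop into thrice as many steps subdivides each of its three
    parts evenly; the middle part stays in a square and telescopes. *)
Lemma triangle_sum c r phi : potential (ball c r) phi -> ball c r p -> ball c r q ->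
  polygonal_sum (n + (n + n)) g =
  polygonal_sum n g1 + incr p q - polygonal_sum n g2.
Proof.
move=> hphi bp bq; rewrite /polygonal_sum.
have nR : n%:R != 0 :> R by rewrite pnatr_eq0 -lt0n.
have nnn : (n + (n + n))%:R = 3 * n%:R :> R by rewrite !natrD; ring.
have frac j : j%:R / (3 * n%:R) = (j%:R / n%:R) / 3 :> R by field.
have I j : (j <= n)%N -> 0 <= (j%:R / n%:R : R) <= 1.
  by move=> jn; have := grid_point n0 jn; rewrite /= in_itv.
pose G (j : nat) := incr (g (j%:R / (n + (n + n))%:R)) (g (j.+1%:R / (n + (n + n))%:R)).
rewrite [LHS](_ : _ = \sum_(0 <= j < n) G j + \sum_(n <= j < n + n) G j +
    \sum_(n + n <= j < n + (n + n)) G j); last first.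
  have l1 : (n <= n + n)%N := leq_addr n n.
  have l2 : (n + n <= n + (n + n))%N by rewrite leq_add2l.
  by rewrite -addrA -(big_cat_nat l1 l2) -(big_cat_nat (leq0n n) (leq_trans l1 l2)).
rewrite /G {G}; congr (_ + _ + _).
- apply: eq_big_nat => j /andP[_ jn].
  by rewrite nnn !frac !triangle1 ?I // ltnW.
- pose h (t : R) := p + t *: (q - p).
  have bh t : 0 <= t <= 1 -> ball c r (h t) by move=> ht; exact: ball_segment.
  rewrite -{1}[n]add0n big_addn addnK.
  rewrite (telescope_sumr_eq (fun j => phi (h (j%:R / n%:R)))) //.
    rewrite mul0r divff // /h scale0r scale1r addr0 [p + _]addrC subrK.
    by rewrite (incrE hphi bp bq).
  move=> j /andP[_ jn].
  have E k : (k <= n)%N -> g ((k + n)%N%:R / (n + (n + n))%:R) = h (k%:R / n%:R).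
    move=> kn; rewrite nnn frac /h -triangle2 ?I //; congr (g (_ / _)).
    by rewrite natrD mulrDl divff // addrC.
  by rewrite -addSn !E ?(ltnW jn) // (incrE hphi) //; apply: bh; apply: I => //; exact: ltnW.
- rewrite -{1}[(n + n)%N]add0n big_addn addnK -sumrN big_nat_rev /= add0n.
  apply: eq_big_nat => j /andP[_ jn].
  have E k : (k <= n)%N -> g ((k + (n + n))%N%:R / (n + (n + n))%:R) = g2 (1 - k%:R / n%:R).
    move=> kn; rewrite nnn frac -triangle3 ?I //; congr (g (_ / _)).
    by rewrite !natrD !mulrDl divff //; ring.
  rewrite -incr_sym -addSn subnSK // !E ?leq_subr //.
  have F k : (k <= n)%N -> 1 - (n - k)%:R / n%:R = k%:R / n%:R :> R.
    by move=> kn; rewrite natrB //; field.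
  by rewrite (F j.+1) // (F j) // ltnW.
Qed.

Lemma triangle_curve c r : curve_in U g1 -> curve_in U g2 ->
  ball c r `<=` U -> ball c r p -> ball c r q -> curve_in U g.
Proof.
move=> cg1 cg2 bU bp bq; split.
  apply: continuous_subspaceT => t.
  have c3 : 3 * s @[s --> t] --> 3 * t by apply: cvgM; [exact: cvg_cst|exact: cvg_id].
  apply: cvgD; first apply: cvgD.
  - exact: (@curve_clip g1 (fun s => 3 * s) t cg1 c3).
  - apply: cvgZ; last exact: cvg_cst.
    have c31 : 3 * s - 1 @[s --> t] --> 3 * t - 1 by apply: cvgB => //; exact: cvg_cst.
    exact: (cvg_comp _ _ c31 (@cvg_clip (3 * t - 1))).
  - apply: cvgB; last exact: cvg_cst.
    apply: (@curve_clip g2 (fun s => 3 - 3 * s) t cg2).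
    by apply: cvgB => //; exact: cvg_cst.
have [[_ U1] [_ U2]] := (cg1, cg2).
move=> t; rewrite /= in_itv /= => /andP[t0 t1].
have [h1|h1] := leP t (1 / 3).
  have -> : t = (3 * t) / 3 by field.
  rewrite triangle1; last by apply/andP; split; lra.
  by apply: U1; rewrite /= in_itv /=; apply/andP; split; lra.
have [h2|h2] := leP t (2 / 3).
  have -> : t = (1 + (3 * t - 1)) / 3 by field.
  rewrite triangle2; last by apply/andP; split; lra.
  by apply/bU/ball_segment => //; apply/andP; split; lra.
have -> : t = (2 + (3 * t - 2)) / 3 by field.
rewrite triangle3; last by apply/andP; split; lra.
by apply: U2; rewrite /= in_itv /=; apply/andP; split; lra.
Qed.

Lemma triangle_closed : g1 0 = g2 0 -> g 0 = g 1.
Proof.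
move=> g12.
have -> : g 0 = g1 0 by rewrite -[0 in LHS](mul0r 3^-1) triangle1 ?lexx ?ler01.
have -> : 1 = (2 + 1) / 3 :> R by field.
by rewrite triangle3 ?lexx ?ler01 // subrr.
Qed.

End Triangle.

(** On a simply connected region a locally exact form is exact: the value of the
    potential at [p] is the eventual value of the polygonal sums along any path
    from the base point to [p]. *)
Lemma global_potential : connected U -> U !=set0 -> simply_connected U ->
  exists Phi, potential U Phi.
Proof.
move=> cU [p0 Up0] [pU lU].
have [gam gamP] : {gam : P -> R -> P & forall p, U p ->
    [/\ curve_in U (gam p), gam p 0 = p0 & gam p 1 = p]}.
  apply: (choice (P := fun p g => U p -> [/\ curve_in U g, g 0 = p0 & g 1 = p])) => p.
  have [Up|nUp] := pselect (U p); last by exists (fun=> p0) => /nUp.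
  by have [g h] := pU p0 p Up0 Up; exists g.
pose S n p := polygonal_sum n (gam p).
have near_sum c r phi p q : potential (ball c r) phi -> ball c r `<=` U ->
    ball c r p -> ball c r q ->
    exists N, forall n, (N <= n)%N -> S n q = S n p + (phi q - phi p).
  move=> hphi bU bp bq.
  have [cp p00 p1] := gamP p (bU _ bp); have [cq q0 q1] := gamP q (bU _ bq).
  have cg := triangle_curve p1 q1 cp cq bU bp bq.
  have gcl := triangle_closed p1 q1 (etrans p00 (esym q0)).
  have [N HN] := null_homotopic_sum (lU _ cg gcl).
  exists N.+1 => n Nn; have n0 : (0 < n)%N by exact: leq_trans Nn.
  have := HN (n + (n + n))%N (leq_trans (ltnW Nn) (leq_addr _ _)).
  rewrite (triangle_sum p1 q1 n0 hphi bp bq) (incrE hphi bp bq) -/(S n p) -/(S n q).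
  by lra.
pose limit p d := exists N, forall n, (N <= n)%N -> S n p - S n p0 = d.
have lim_translate c r phi p q d : potential (ball c r) phi -> ball c r `<=` U ->
    ball c r p -> ball c r q -> limit p d -> limit q (d + (phi q - phi p)).
  move=> hphi bU bp bq [N HN]; have [M HM] := near_sum c r phi p q hphi bU bp bq.
  exists (maxn N M) => n; rewrite geq_max => /andP[/HN h /HM ->]; rewrite -h.
  by ring.
have lim_ex p : U p -> exists d, limit p d.
  apply: (@connected_propagate _ U (fun p => exists d, limit p d) p0) => //; last first.
    by exists 0, 0%N => n _; rewrite subrr.
  move=> {}p Up; have [r [phi [r0 bU hphi]]] := potential_near Up.
  have : nbhs p (ball p r) by exact: nbhsx_ballx.
  apply: filterS => q bq _; have bp := ballxx p r0.
  by split=> -[d hd]; eexists; [exact: (lim_translate _ _ _ _ _ _ hphi bU bp bq hd)|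
    exact: (lim_translate _ _ _ _ _ _ hphi bU bq bp hd)].
have lim_unique p d d' : limit p d -> limit p d' -> d = d'.
  move=> [N HN] [M HM]; rewrite -(HN (maxn N M)) ?leq_maxl //.
  by rewrite -(HM (maxn N M)) ?leq_maxr.
pose Phi p := xget 0 [set d | limit p d].
have PhiP p : U p -> limit p (Phi p).
  by move=> /lim_ex[d hd]; rewrite /Phi; case: xgetP => [? _ //|/(_ d)].
exists Phi => p Up; have [r [phi [r0 bU hphi]]] := potential_near Up.
have bp := ballxx p r0.
have E : \forall z \near p, Phi p - phi p + phi z = Phi z.
  have : nbhs p (ball p r) by exact: nbhsx_ballx.
  apply: filterS => z bz; apply: lim_unique (PhiP _ (bU _ bz)).
  have := lim_translate _ _ _ _ _ _ hphi bU bp bz (PhiP _ Up).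
  by rewrite addrA addrAC.
have [d1 d2] := hphi p bp.
split; apply: (near_is_derive E).
  by rewrite -[A p]add0r; exact: (is_derive_sum (is_derive_cst (Phi p - phi p) p ex) d1).
by rewrite -[B p]add0r; exact: (is_derive_sum (is_derive_cst (Phi p - phi p) p ey) d2).
Qed.

End Monodromy.

(** * Goursat representation of biharmonic functions *)

Section GoursatRepresentation.
Context {R : realType} (U : set (R * R)).
Local Notation P := (R * R)%type.
Local Notation C := R[i].
Local Notation re := (@complex.Re R).
Local Notation im := (@complex.Im R).
Implicit Types (p q z c : P) (u v F G : P -> R) (f g : P -> C).
Context (regionU : region U) (scU : simply_connected U).

Let oU : open U. Proof. by case: regionU. Qed.

Lemma closed_form_exact (A B d : P -> R) :
  (forall z, U z -> [/\ {for z, continuous A}, {for z, continuous B} &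
     {for z, continuous d}]) ->
  (forall z, U z -> is_derive z ey A (d z) /\ is_derive z ex B (d z)) ->
  exists Phi, potential A B U Phi.
Proof.
move=> cont der; have [_ cU U0] := regionU.
apply: global_potential => // c r r0 bU.
exact: (local_potential r0 (fun z hz => cont z (bU z hz)) (fun z hz => der z (bU z hz))).
Qed.

(** A harmonic function on a simply connected region is the real part of a
    derivative of a holomorphic function.  Passing to the primitive, whose
    derivative [u + i v] is visibly differentiable, provides the two complex
    derivatives on which the regularity theory rests. *)
Lemma harmonic_real_part u : class_C 2 U u -> (forall p, U p -> laplacian u p = 0) ->
  exists f, hol U f /\ forall p, U p -> re (cD f p) = u p.
Proof.
move=> Cu hu; have [Cx Cy] := class_C_partials Cu.
have c0 := class_C_cont Cu; have cx0 := class_C_cont Cx; have cy0 := class_C_cont Cy.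
have [Cxx _] := class_C_partials Cx; have cxx0 := class_C_cont Cxx.
have du p (Up : U p) := class_C_is_derive Cu Up.
have dux p (Up : U p) := class_C_is_derive Cx Up.
have duy p (Up : U p) := class_C_is_derive Cy Up.
have [v hv] : exists v, potential (fun z => - 'D_ey u z) ('D_ex u) U v.
  apply: (@closed_form_exact _ _ ('D_ex ('D_ex u))) => z Uz.
    by split; [apply: cvgN; exact: cy0|exact: cx0|exact: cxx0].
  split; last exact: (dux z Uz).1.
  have := hu z Uz; rewrite /laplacian => /eqP; rewrite addr_eq0 => /eqP ->.
  exact: is_derive_opp (duy z Uz).2.
have dh p : U p -> cderiv (fun z => (u z +i* v z)%C) p
    ('D_ex u p +i* - 'D_ey u p)%C.
  move=> Up; apply: (@cauchy_riemann _ u v ('D_ex u) (fun z => - 'D_ey u z)).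
  - by apply: filterS (open_near oU Up) => z /du; rewrite opprK.
  - by apply: filterS (open_near oU Up) => z /hv.
  - exact: cx0.
  - by apply: cvgN; exact: cy0.
have cv p : U p -> {for p, continuous v}.
  by move=> /dh /cderiv_ccont [].
have [w1 hw1] : exists w1, potential u (fun z => - v z) U w1.
  apply: (@closed_form_exact _ _ ('D_ey u)) => z Uz.
    by split; [exact: c0|apply: cvgN; exact: cv|exact: cy0].
  split; first exact: (du z Uz).2.
  by rewrite -[X in is_derive _ _ _ X]opprK; exact: is_derive_opp (hv z Uz).1.
have [w2 hw2] : exists w2, potential v u U w2.
  apply: (@closed_form_exact _ _ ('D_ex u)) => z Uz.
    by split; [exact: cv|exact: c0|exact: cx0].
  by split; [exact: (hv z Uz).2|exact: (du z Uz).1].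
have df p : U p -> cderiv (fun z => (w1 z +i* w2 z)%C) p (u p +i* v p)%C.
  move=> Up; apply: cauchy_riemann.
  - by apply: filterS (open_near oU Up) => z /hw1.
  - by apply: filterS (open_near oU Up) => z /hw2.
  - exact: c0.
  - exact: cv.
exists (fun z => (w1 z +i* w2 z)%C); split=> [p Up|p /df /cD_cderiv -> //].
exists (fun z => (u z +i* v z)%C); first by apply: filterS (open_near oU Up).
by eexists; exact: dh.
Qed.

Lemma laplacianB F G p : class_C 2 U F -> class_C 2 U G -> U p ->
  laplacian (fun z => F z - G z) p = laplacian F p - laplacian G p.
Proof.
move=> CF CG Up; have [Fx Fy] := class_C_partials CF; have [Gx Gy] := class_C_partials CG.
have D1x z : U z -> 'D_ex (fun z => F z - G z) z = 'D_ex F z - 'D_ex G z.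
  move=> Uz; have [h1 _] := class_C_is_derive CF Uz; have [h2 _] := class_C_is_derive CG Uz.
  by case: (is_derive_diff h1 h2).
have D1y z : U z -> 'D_ey (fun z => F z - G z) z = 'D_ey F z - 'D_ey G z.
  move=> Uz; have [_ h1] := class_C_is_derive CF Uz; have [_ h2] := class_C_is_derive CG Uz.
  by case: (is_derive_diff h1 h2).
have D2x : 'D_ex ('D_ex (fun z => F z - G z)) p = 'D_ex ('D_ex F) p - 'D_ex ('D_ex G) p.
  rewrite (@near_derive _ _ (fun z => 'D_ex F z - 'D_ex G z)); last first.
    by apply: filterS (open_near oU Up) => z; exact: D1x.
  have [h1 _] := class_C_is_derive Fx Up; have [h2 _] := class_C_is_derive Gx Up.
  by case: (is_derive_diff h1 h2).
have D2y : 'D_ey ('D_ey (fun z => F z - G z)) p = 'D_ey ('D_ey F) p - 'D_ey ('D_ey G) p.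
  rewrite (@near_derive _ _ (fun z => 'D_ey F z - 'D_ey G z)); last first.
    by apply: filterS (open_near oU Up) => z; exact: D1y.
  have [_ h1] := class_C_is_derive Fy Up; have [_ h2] := class_C_is_derive Gy Up.
  by case: (is_derive_diff h1 h2).
transitivity (('D_ex ('D_ex F) p - 'D_ex ('D_ex G) p) +
  ('D_ey ('D_ey F) p - 'D_ey ('D_ey G) p)); last by rewrite /laplacian opprD addrACA.
rewrite [LHS]/laplacian.
exact (f_equal2 (fun a b : R => a + b) D2x D2y).
Qed.

(** Goursat's theorem: [f] is a quarter of a primitive of the holomorphic function
    with real part [laplacian F], and what remains of [F] is harmonic. *)
Lemma goursat_representation F : biharmonic U F ->
  exists f g, [/\ hol U f, hol U g & forall p, U p -> F p = goursat f g p].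
Proof.
move=> [CF bF]; have [Cx Cy] := class_C_partials CF.
have [Cxx _] := class_C_partials Cx; have [_ Cyy] := class_C_partials Cy.
have CL : class_C 2 U (laplacian F) := class_CD oU Cxx Cyy.
have [f0 [hf0 f0E]] := harmonic_real_part CL bF.
pose f z : C := ((4^-1 : R)%:C)%C * f0 z.
have hf : hol U f.
  by move=> p Up; apply: twiceM; [exact: twice_cst|exact: hf0].
have h0 : hol U (fun=> 0 : C) by move=> p _; exact: twice_cst.
have Cf : class_C 2 U (goursat f (fun=> 0)) := goursat_class_C oU 2 hf h0.
have CF2 : class_C 2 U F := class_C_leS (class_C_leS CF).
have [g0 [hg0 g0E]] : exists g0, hol U g0 /\
    forall p, U p -> re (cD g0 p) = F p - goursat f (fun=> 0) p.
  apply: (harmonic_real_part (class_CD oU CF2 (class_CN oU Cf))) => p Up.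
  rewrite (laplacianB CF2 Cf Up) (laplacian_goursat oU hf h0 Up).
  have -> : cD f p = ((4^-1 : R)%:C)%C * cD f0 p.
    by apply/cD_cderiv/cderivZ/twice_cD/hf0.
  by rewrite reM reR imR mul0r subr0 f0E //; field.
exists f, (cD g0); split => // [|p Up]; first exact: hol_cD.
have := g0E p Up; rewrite /goursat !reD re0; lra.
Qed.

End GoursatRepresentation.

(** * Schwarz reflection in a circle *)

Section SchwarzReflection.
Context {R : realType} (O : R * R) (a : R) (a_gt0 : 0 < a).
Local Notation P := (R * R)%type.
Local Notation C := R[i].
Local Notation re := (@complex.Re R).
Local Notation im := (@complex.Im R).
Implicit Types (p q z c : P) (u v F G : P -> R) (f g K : P -> C) (U E D : set P).

(** The Schwarz function of the circle: it agrees with [conj z] on the circle, and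
    the inversion is its conjugate. *)
Definition schwarz z : C := conjc (cx O) + ((a ^+ 2)%:C)%C * (cx z - cx O)^-1.

Lemma conjcD (x y : C) : conjc (x + y) = conjc x + conjc y.
Proof. exact: rmorphD. Qed.
Lemma conjcB (x y : C) : conjc (x - y) = conjc x - conjc y.
Proof. exact: rmorphB. Qed.
Lemma conjcM (x y : C) : conjc (x * y) = conjc x * conjc y.
Proof. exact: rmorphM. Qed.

Lemma enorm_cx p : enorm p = normc (cx p).
Proof. by rewrite normcE. Qed.

Lemma inversionE z : inversion O a z = pt (conjc (schwarz z)).
Proof.
apply: cx_inj; rewrite ptK /schwarz conjcD conjcM conjcK conjc_real.
have -> : cx (inversion O a z) =
    cx O + ((a ^+ 2 / enorm (z - O) ^+ 2)%:C)%C * cx (z - O).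
  apply: complex_eq; rewrite !(reD, imD, reM, imM, reR, imR) !mul0r ?subr0 ?addr0 //.
have -> : cx (z - O) = cx z - cx O by [].
have -> : (cx z - cx O)^-1 = ((normc (cx z - cx O) ^+ 2)^-1)%:C%C * conjc (cx z - cx O).
  exact: invcE.
rewrite conjcM conjc_real conjcK enorm_cx.
have -> : cx (z - O) = cx z - cx O by [].
by rewrite rmorphM mulrA.
Qed.

Lemma a2_neq0 : ((a ^+ 2)%:C)%C != 0 :> C.
Proof. by rewrite -normc_eq0 normc_real normr_eq0 expf_eq0 /= gt_eqF. Qed.

Lemma cx_inversion z : cx (inversion O a z) - cx O =
  conjc (((a ^+ 2)%:C)%C * (cx z - cx O)^-1).
Proof. by rewrite inversionE ptK /schwarz conjcD conjcK addrAC subrr add0r. Qed.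

Lemma inversion_neq z : z != O -> inversion O a z != O.
Proof.
move=> zO; rewrite -cxB_eq0 cx_inversion conjc_eq0.
by rewrite mulf_neq0 ?a2_neq0 // invr_eq0 cxB_eq0.
Qed.

Lemma inversionK z : z != O -> inversion O a (inversion O a z) = z.
Proof.
move=> zO; have w0 : cx z - cx O != 0 by rewrite cxB_eq0.
apply: cx_inj; apply: (addIr (- cx O)); rewrite cx_inversion cx_inversion.
rewrite -conjc_inv -[((a ^+ 2)%:C)%C in X in conjc X]conjc_real -conjcM conjcK.
rewrite conjc_real; have a1 : (a%:C)%C != 0 :> C.
  by rewrite -normc_eq0 normc_real normr_eq0 gt_eqF.
field; rewrite w0; exact: a1.
Qed.

Lemma inversion_imageP U z :
  inversion_image O a U z <-> z != O /\ U (inversion O a z).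
Proof.
split=> [[q [Uq /eqP qO] <-]|[zO Ur]].
  by rewrite inversionK //; split => //; exact: inversion_neq.
exists (inversion O a z); last exact: inversionK.
by split => //; exact/eqP/inversion_neq.
Qed.

Lemma twice_schwarz z : z != O -> twice schwarz z.
Proof.
move=> zO; apply: twiceD; first exact: twice_cst.
apply: twiceM; first exact: twice_cst.
apply: twiceV; first by rewrite cxB_eq0.
by apply: twiceB; [exact: twice_cx|exact: twice_cst].
Qed.

Lemma near_neq z : z != O -> \forall w \near z, w != O.
Proof.
rewrite -cxB_eq0 => zO.
have h : ccont (fun w => cx w - cx O) z.
  by apply: ccontB; [exact: ccont_cx|exact: ccont_cst].
by have := ccont_neq0 h zO; apply: filterS => w; rewrite cxB_eq0.
Qed.

Lemma open_inversion_image U : open U -> open (inversion_image O a U).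
Proof.
move=> oU; rewrite openE => z /inversion_imageP[zO Ur].
have cs : ccont schwarz z := twice_ccont (twice_schwarz zO).
have ci : pt (conjc (schwarz w)) @[w --> z] --> pt (conjc (schwarz z)).
  by apply: continuous_pt; exact: ccontJ.
have nU : nbhs (pt (conjc (schwarz z))) U.
  by rewrite -inversionE; exact: open_near.
have {nU}nU : \forall w \near z, U (pt (conjc (schwarz w))) := ci _ nU.
apply: (@filterS2 _ (nbhs z) _ _ _ _ _ (near_neq zO) nU) => w wO wU.
by apply/inversion_imageP; rewrite inversionE.
Qed.

Lemma circle_schwarz z : circle O a z ->
  z != O /\ schwarz z = conjc (cx z).
Proof.
rewrite /circle /= enorm_cx => za.
have n0 : normc (cx z - cx O) = a by [].
have w0 : cx z - cx O != 0 by rewrite -normc_eq0 n0 gt_eqF.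
split; first by rewrite -cxB_eq0.
rewrite /schwarz invcE n0 mulrA -rmorphM divff ?expf_neq0 ?gt_eqF //.
by rewrite rmorph1 mul1r conjcB addrC subrK.
Qed.

(** Points of the circle accumulate at each of its points: rotate by the unit
    numbers [(1 + it) / (1 - it)], rationally parametrised by small [t]. *)
Lemma circle_points_near q n (d : R) : circle O a q -> 0 < d ->
  exists s : seq P, [/\ size s = n, uniq s & forall z, z \in s ->
     circle O a z /\ normc (cx z - cx q) <= d].
Proof.
move=> qa d0; have nq : normc (cx q - cx O) = a by move: qa; rewrite /circle /= enorm_cx.
pose t (j : nat) : R := d / (2 * a) / j.+1%:R.
pose num j : C := (1 +i* t j)%C; pose den j : C := (1 -i* t j)%C.
have dE j : den j = conjc (num j) by [].
have num0 j : num j != 0 by rewrite -normc_eq0 normcE /= gt_eqF // sqrtr_gt0 ltr_pwDl ?sqr_ge0 ?exprn_gt0.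
have den0 j : den j != 0 by rewrite dE conjc_eq0.
have den1 j : 1 <= normc (den j).
  rewrite dE normc_conj; apply: le_trans (re_le_normc _).
  by rewrite /num /= normr1.
pose e j := num j / den j.
have ne j : normc (e j) = 1.
  by rewrite normc_div dE normc_conj divff // normc_eq0.
have t0 j : 0 <= t j by rewrite !divr_ge0 ?mulr_ge0 // ltW.
have td j : a * (2 * t j) <= d.
  have -> : a * (2 * t j) = d / j.+1%:R.
    have j0 : 1 + j%:R != 0 :> R by rewrite -[1]/(1%:R) -natrD pnatr_eq0.
    by rewrite /t -nat1r; field; rewrite ?j0 gt_eqF.
  by rewrite ler_pdivrMr ?ltr0n // ler_peMr ?ler1n // ltW.
pose z j := pt (cx O + (cx q - cx O) * e j).
exists [seq z j | j <- iota 0 n]; split.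
- by rewrite size_map size_iota.
- rewrite map_inj_uniq ?iota_uniq // => j k /(congr1 cx); rewrite !ptK => /addrI.
  have q0 : cx q - cx O != 0 by rewrite -normc_eq0 nq gt_eqF.
  move=> /(mulfI q0) /eqP; rewrite /e eqr_div // => /eqP.
  rewrite /num /den => /(congr1 im); rewrite !imM /= => h.
  have {}h : t j = t k by lra.
  move: h; rewrite /t => /(mulfI _) h.
  have /h : d / (2 * a) != 0 by rewrite mulf_neq0 ?gt_eqF // invr_gt0 mulr_gt0.
  by move=> /invr_inj/eqP; rewrite eqr_nat eqSS => /eqP.
- move=> w /mapP[j _ ->]; split.
    rewrite /circle /= enorm_cx.
    have -> : cx (z j - O) = cx (z j) - cx O by [].
    by rewrite ptK addrAC subrr add0r normcrM nq ne mulr1.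
  have -> : cx (z j) - cx q = (cx q - cx O) * ((num j - den j) / den j).
    by rewrite ptK /e; field.
  rewrite normcrM nq normc_div; apply: le_trans (td j).
  rewrite ler_pM2l // ler_pdivrMr ?(lt_le_trans _ (den1 j)) //.
  have -> : num j - den j = (0 +i* (2 * t j))%C.
    by apply: complex_eq; rewrite !(reD, imD, reN, imN) /=; lra.
  have n2 : normc (0 +i* (2 * t j))%C <= 2 * t j.
    apply: le_trans (normc_le_add _) _.
    by rewrite /= normr0 add0r ger0_norm // mulr_ge0.
  by apply: le_trans n2 _; rewrite ler_peMr // mulr_ge0.
Qed.

(** The reflected function [K] is defined without reference to connectedness;
    only its agreement with [s f + g] needs a connected set that meets the circle,
    and there the zeros of the difference come from a whole arc. *)
Lemma schwarz_reflection U F f g : open U -> hol U f -> hol U g ->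
  (forall p, U p -> F p = goursat f g p) -> linear_on (circle O a `&` U) F ->
  exists K, hol (inversion_image O a U) K /\
   forall E D, open E -> E `<=` U `&` inversion_image O a U -> connected D ->
     D `<=` E -> circle O a `&` D !=set0 ->
     forall p, D p -> \forall z \near p, K z = schwarz z * f z + g z.
Proof.
move=> oU hf hg FE [al [be [gm lin]]].
pose l z : C := (al -i* be)%C * cx z + (gm%:C)%C.
pose H z := schwarz z * f z + g z - l z.
pose K z := - conjc (H (pt (conjc (schwarz z)))) + l z.
have tl z : twice l z.
  by apply: twiceD; [apply: twiceM; [exact: twice_cst|exact: twice_cx]|exact: twice_cst].
have tH z : U z -> z != O -> twice H z.
  move=> Uz zO; apply: twiceB => //; apply: twiceD; last exact: hg.
  by apply: twiceM; [exact: twice_schwarz|exact: hf].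
have hK : hol (inversion_image O a U) K.
  move=> z /inversion_imageP[zO Ur]; apply: twiceD => //; apply: twiceN.
  apply: twice_reflect; last exact: twice_schwarz.
  by rewrite -inversionE; apply: tH => //; exact: inversion_neq.
exists K; split=> // E D oE EU cD DE [q [qa Dq]].
pose W z := K z - (schwarz z * f z + g z).
have hW : hol E W.
  move=> z /EU[Uz Iz]; have [zO _] := (inversion_imageP _ _).1 Iz.
  apply: twiceB; first exact: hK.
  apply: twiceD; last exact: hg.
  by apply: twiceM; [exact: twice_schwarz|exact: hf].
have W0 z : circle O a z -> U z -> W z = 0.
  move=> za Uz; have [zO sz] := circle_schwarz za.
  have reH : re (H z) = 0.
    rewrite /H reD reN sz.
    have -> : re (conjc (cx z) * f z + g z) = F z by rewrite FE.
    rewrite lin // /l reD reM /=; lra.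
  have cH : conjc (H z) = - H z.
    by apply: complex_eq; rewrite ?reJ ?imJ ?reN ?imN // reH oppr0.
  by rewrite /W /K sz conjcK cxK cH opprK /H sz; ring.
suff Wz p : D p -> \forall z \near p, W z = 0.
  by move=> p /Wz; apply: filterS => z /eqP; rewrite subr_eq0 => /eqP.
apply: (identity_connected oE hW DE cD Dq).
have /near_discP[r r0 rE] := open_near oE (DE _ Dq).
have r2 : 0 < r / 2 by rewrite divr_gt0.
have sub z : cdisc q (r / 2) z -> E z.
  by rewrite cdiscE => zr; apply: rE; lra.
have Wq : forall z, cdisc q (r / 2 / 2) z -> W z = 0.
  apply: (infinite_zeros r2 (fun z hz => hW z (sub z hz))) => n.
  have d0 : 0 < r / 2 / 8 by rewrite divr_gt0.
  have [s [sn us sP]] := circle_points_near n qa d0.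
  exists s; split => // z /sP[za zd]; split => //.
  apply: W0 => //; have Ez : E z by apply: sub; rewrite cdiscE; lra.
  by have [] := EU _ Ez.
have : nbhs q (cdisc q (r / 2 / 2)) by apply: nbhs_cdisc; rewrite subrr normcr0 divr_gt0.
by apply: filterS.
Qed.

End SchwarzReflection.

Theorem lemma5 (R : realType) (O1 O2 : R * R) (a1 a2 : R)
    (a1_gt0 : 0 < a1) (a2_gt0 : 0 < a2)
    (neq_S : circle O1 a1 <> circle O2 a2)
    (U : set (R * R)) (regionU : region U) (scU : simply_connected U)
    (niceU : nicely_arranged O1 a1 O2 a2 U)
    (F : R * R -> R) (biF : biharmonic U F)
    (linF1 : linear_on (circle O1 a1 `&` U) F)
    (linF2 : linear_on (circle O2 a2 `&` U) F) :
  extends_biharmonically U F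
    ((inversion_image O1 a1 U `&` inversion_image O2 a2 U)
       `\` limit_set O1 a1 O2 a2).
Proof.
have oU : open U by case: regionU.
have [f [g [hf hg FE]]] := goursat_representation regionU scU biF.
have [K1 [hK1 K1E]] := schwarz_reflection a1_gt0 oU hf hg FE linF1.
have [K2 [hK2 K2E]] := schwarz_reflection a2_gt0 oU hf hg FE linF2.
set V := _ `\` _.
pose s1 := schwarz O1 a1; pose s2 := schwarz O2 a2.
have VO z : V z -> z != O1 /\ z != O2.
  move=> [[/(inversion_imageP O1 a1_gt0)[z1 _] /(inversion_imageP O2 a2_gt0)[z2 _]] _].
  by [].
have ss z : V z -> s1 z - s2 z != 0.
  move=> Vz; have [/eqP z1 /eqP z2] := VO z Vz; have [_ nS] := Vz.
  apply/negP; rewrite subr_eq0 => /eqP s12; apply: nS.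
  by split => //; rewrite !inversionE -/s1 -/s2 s12.
have ts z : z != O1 -> z != O2 -> twice (fun w => s1 w - s2 w) z.
  by move=> z1 z2; apply: twiceB; exact: twice_schwarz.
have oV : open V.
  rewrite openE => z Vz; have [z1 z2] := VO z Vz; have [[I1 I2] _] := Vz.
  have o1 := open_near (open_inversion_image (O:=O1) a1_gt0 oU) I1.
  have o2 := open_near (open_inversion_image (O:=O2) a2_gt0 oU) I2.
  have o3 := ccont_neq0 (twice_ccont (ts z z1 z2)) (ss z Vz).
  apply: (@filterS2 _ (nbhs z) _ _ _ _ _ (filterI o1 o2) o3) => w w12 ws.
  split => // -[_ _]; rewrite !inversionE => /(congr1 cx); rewrite !ptK.
  by move=> /(can_inj (@conjcK R)) s12; move: ws; rewrite /s1 /s2 s12 subrr eqxx.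
pose f' z := (K1 z - K2 z) / (s1 z - s2 z).
pose g' z := K1 z - s1 z * f' z.
have hf' : hol V f'.
  move=> z Vz; have [z1 z2] := VO z Vz; have [[I1 I2] _] := Vz.
  apply: twiceM; first by apply: twiceB; [exact: hK1|exact: hK2].
  by apply: twiceV; [exact: ss|exact: ts].
have hg' : hol V g'.
  move=> z Vz; have [z1 z2] := VO z Vz; have [[I1 I2] _] := Vz.
  apply: twiceB; first exact: hK1.
  by apply: twiceM; [exact: twice_schwarz|exact: hf'].
split => //; exists (goursat f' g'); first exact: biharmonic_goursat.
have [D [[p0 Ep0 DE] c1 c2]] := niceU.
set E := (U `&` _ `&` _) `\` _ in Ep0 DE.
have EV : E `<=` U `&` V by move=> z [[[? ?] ?] ?].
have VE : U `&` V `<=` E by move=> z [Uz [[? ?] ?]].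
have EE : E = U `&` V by apply/seteqP.
have oE : open E by rewrite EE; exact: openI.
have DsE : D `<=` E by rewrite DE; exact: connected_component_sub.
have cD : connected D by rewrite DE; exact: component_connected.
have Dp0 : D p0 by rewrite DE; exact: connected_component_refl.
have k1 : \forall z \near p0, K1 z = s1 z * f z + g z.
  by apply: (K1E E D oE _ cD DsE c1 p0 Dp0) => z /EV[Uz [[? ?] _]].
have k2 : \forall z \near p0, K2 z = s2 z * f z + g z.
  by apply: (K2E E D oE _ cD DsE c2 p0 Dp0) => z /EV[Uz [[? ?] _]].
pose good z := (K1 z = s1 z * f z + g z /\ K2 z = s2 z * f z + g z) /\ E z.
exists (good^°); split.
- exact: open_interior.
- exists p0; apply: filterI; [exact: filterI|exact: open_near].
- by move=> z /interior_subset[_ /EV].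
- move=> z /interior_subset[[e1 e2] /EV[Uz Vz]]; rewrite (FE z Uz).
  have n0 := ss z Vz.
  have ff : f' z = f z by rewrite /f' e1 e2; field.
  by rewrite /goursat /g' ff e1; congr (complex.Re (_ + _)); ring.
Qed.
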